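(* Let $K>0$ and let $a_K$ and $a_{K,A}$ ($A>0$) be the diffusion coefficients described in the context. For any $n\in(1,+\infty)$ it holds $$\mathbb E\Big(\operatorname*{ess\,sup}_{\underline x\in\mathcal D}a_K(\underline x)^n\Big)^{\frac1n}<+\infty .$$ Further, for any $\delta>0$ there exists a constant $A=A(\delta,n)>0$ such that $$\mathbb E\Big(\operatorname*{ess\,sup}_{\underline x\in\mathcal D}|a_K(\underline x)-a_{K,A}(\underline x)|^n\Big)^{1/n}<\delta .$$
   Context: $(\Omega,\mathcal F,\mathbb P)$ is a complete probability space, $0<D<+\infty$, $\mathcal D=(0,D)^2$. With $\chi_B(z)=\min(z,B)$ for $z\ge0$ and $B>0$, $$a_K(\omega,x,y)=\overline a(x,y)+\Phi_1(W_1(x,y))+\Phi_2\big(W_2(\chi_K(l_1(x)),\chi_K(l_2(y)))\big),\qquad a_{K,A}=\chi_A(a_K).$$ Standing assumptions: (i) $W_1$, $W_2$ are stochastically independent zero-mean Gaussian random fields on $[0,D]^2$ and $[0,K]^2$ with $\mathbb P$-a.s. continuous paths. With covariance functions $q_1,q_2$, covariance operators $Q_j\phi=\int_{[0,z_j]^2}q_j(\cdot,(x',y'))\phi(x',y')\,d(x',y')$ ($z=(D,K)$) and eigenpairs $(\lambda_i^{(j)},e_i^{(j)},\ i\in\mathbb N)$, where $(e_i^{(j)})_i$ is an orthonormal basis of $L^2([0,z_j]^2)$, the eigenfunctions are continuously differentiable and there are $\alpha,\beta,C_e,C_\lambda>0$ with $\|e_i^{(j)}\|_{L^\infty([0,z_j]^2)}\le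 C_e$, $\|\nabla e_i^{(j)}\|_{L^\infty([0,z_j]^2)}\le C_e i^\alpha$ for all $i\in\mathbb N$, $j=1,2$, and $\sum_{i=1}^\infty(\lambda_i^{(1)}+\lambda_i^{(2)})i^\beta\le C_\lambda<\infty$. (ii) $\Phi_1,\Phi_2:\mathbb R\to[0,+\infty)$ are continuous, $\Phi_1\in C^1(\mathbb R)$, $|\Phi_1'(x)|\le\phi\exp(\psi|x|)$ and $|\Phi_2(x)-\Phi_2(y)|\le C_{lip}|x-y|$ for $x,y\in\mathbb R$, with constants $\phi,\psi,C_{lip}>0$. (iii) $\overline a:\mathcal D\to(0,+\infty)$ is deterministic, continuous, $0<\overline a_-\le\overline a\le\overline a_+<\infty$. (iv) $l_1,l_2$ are Lévy subordinators on $[0,D]$ ($\mathbb P$-a.s. non-decreasing Lévy processes starting at $0$, càdlàg paths) independent of $W_1,W_2$. *)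

(* Defs.v *)
From HB Require Import structures.
From mathcomp Require Import all_boot all_order all_algebra.
From mathcomp Require Import all_classical all_reals all_analysis ess_sup_inf.

Set Implicit Arguments.
Unset Strict Implicit.
Unset Printing Implicit Defensive.

Import Order.TTheory GRing.Theory Num.Theory.
Import numFieldNormedType.Exports.

Local Open Scope classical_set_scope.
Local Open Scope ring_scope.

Section squares.
Context {R : realType}.
Implicit Types b : R.

Definition osquare b : set (R * R) := `]0, b[ `*` `]0, b[.
Definition csquare b : set (R * R) := `[0, b] `*` `[0, b].

Lemma measurable_osquare b : measurable (osquare b).
Proof. exact: measurableX. Qed.

Lemma measurable_csquare b : measurable (csquare b).
Proof. exact: measurableX. Qed.

End squares.

Notation lebesgue2 := (lebesgue_measure \x lebesgue_measure)%E.

(* Random fields and processes are families over all of R * R or R; only their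
   members with index in the relevant square or interval are constrained. *)
Section random_objects.
Context d (T : measurableType d) (R : realType) (P : probability T R).

(* normal_prob m 0 is not the Dirac mass at m (normal_pdf m 0 is the indicator
   of [0, 1]), whence the case distinction. *)
Definition gaussian_rv (X : T -> R) : Prop :=
  exists m s : R, forall B : set R, measurable B ->
    P (X @^-1` B) = if s == 0 then \d_m B else normal_prob m s B.

(* The vector (W (z 0), ..., W (z (n - 1))) is multivariate normal, possibly
   degenerate, iff all linear combinations of its entries are normal. *)
Definition gaussian_field (S : set (R * R)) (W : R * R -> {RV P >-> R}) : Prop :=
  forall (n : nat) (z : 'I_n -> R * R) (c : 'I_n -> R), (forall i, S (z i)) ->
    gaussian_rv (fun w => \sum_(i < n) c i * W (z i) w).

Definition zero_mean (S : set (R * R)) (W : R * R -> {RV P >-> R}) : Prop :=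
  forall z, S z -> ('E_P[W z] = 0)%E.

Definition ae_continuous_paths (S : set (R * R))
    (W : R * R -> {RV P >-> R}) : Prop :=
  {ae P, forall w, {within S, continuous (fun z => W z w)}}.

(* covariance is \bar R-valued; it is finite for Gaussian fields. *)
Definition cov_fun (W : R * R -> {RV P >-> R}) (z z' : R * R) : R :=
  fine (covariance P (W z) (W z')).

Definition cov_op (b : R) (W : R * R -> {RV P >-> R}) (phi : R * R -> R)
    (z : R * R) : R :=
  \int[lebesgue2]_(z' in csquare b) (cov_fun W z z' * phi z').

Definition rv_events (I : Type) (S : set I) (X : I -> {RV P >-> R}) :
    set (set T) :=
  \bigcup_(i in S) preimage_set_system [set: T] (X i) measurable.

Definition independent_sigma (F G : set (set T)) : Prop :=
  forall A B, <<s F >> A -> <<s G >> B -> (P (A `&` B) = P A * P B)%E.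

Record levy_process (D : R) (l : R -> {RV P >-> R}) : Prop := {
  levy_start : {ae P, forall w, l 0 w = 0} ;
  levy_independent_increments : forall (n : nat) (t : nat -> R)
      (B : 'I_n -> set R),
    (forall i, (i <= n)%N -> 0 <= t i <= D) ->
    (forall i, (i < n)%N -> t i <= t i.+1) ->
    (forall i, measurable (B i)) ->
    P [set w | forall i : 'I_n, B i (l (t i.+1) w - l (t i) w)] =
    (\prod_(i < n) P [set w | B i (l (t i.+1) w - l (t i) w)%R])%E ;
  levy_stationary_increments : forall (s t : R) (B : set R),
    0 <= s -> s <= t -> t <= D -> measurable B ->
    P [set w | B (l t w - l s w)] = P [set w | B (l (t - s) w)] ;
  levy_stochastically_continuous : forall t eps : R, 0 <= t <= D -> 0 < eps ->
    P [set w | eps < `|l s w - l t w|] @[s --> within `[0, D] (nbhs t)] --> 0%E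
}.

Record levy_subordinator (D : R) (l : R -> {RV P >-> R}) : Prop := {
  subordinator_levy : levy_process D l ;
  subordinator_nondecreasing :
    {ae P, forall w, {in `[0, D] &, {homo (fun t => l t w) : s t / s <= t}}} ;
  subordinator_cadlag : {ae P, forall w,
    (forall t, 0 <= t < D -> l s w @[s --> t^'+] --> l t w) /\
    (forall t, 0 < t <= D -> cvg (l s w @[s --> t^'-]))}
}.

End random_objects.

Section eigenpairs.
Context {R : realType}.
Implicit Types (b : R) (f g : R * R -> R).

(* C^1 up to the boundary: on the open square the partial derivatives exist and
   extend continuously to the closed square. *)
Definition C1_csquare b f : Prop :=
  {within csquare b, continuous f} /\
  exists g1 g2 : R * R -> R,
    [/\ {within csquare b, continuous g1}, {within csquare b, continuous g2} &
        forall z, osquare b z ->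
          [/\ differentiable f z, 'D_(1, 0) f z = g1 z & 'D_(0, 1) f z = g2 z]].

Definition grad_norm f (z : R * R) : R :=
  Num.sqrt (('D_(1, 0) f z) ^+ 2 + ('D_(0, 1) f z) ^+ 2).

Definition Linfty_norm b f : \bar R :=
  'N[mrestr lebesgue2 (measurable_csquare b)]_+oo[EFin \o f]%E.

Definition L2_inner b f g : R :=
  \int[lebesgue2]_(z in csquare b) (f z * g z).

Definition L2_csquare b f : Prop :=
  measurable_fun (csquare b) f /\
  (\int[lebesgue2]_(z in csquare b) ((f z) ^+ 2)%R%:E < +oo)%E.

Definition L2_orthonormal_basis b (e : nat -> R * R -> R) : Prop :=
  [/\ forall i, L2_csquare b (e i),
      forall i j, L2_inner b (e i) (e j) = (i == j)%:R &
      forall f, L2_csquare b f ->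
        (\int[lebesgue2]_(z in csquare b)
           ((f z - \sum_(i < N) L2_inner b f (e i) * e i z) ^+ 2)%R%:E)%E
          @[N --> \oo] --> 0%E].

Definition eigenpairs_of d (T : measurableType d) (P : probability T R) b
    (W : R * R -> {RV P >-> R}) (lam : nat -> R) (e : nat -> R * R -> R) : Prop :=
  L2_orthonormal_basis b e /\
  forall i, {ae lebesgue2, forall z, csquare b z ->
                             cov_op b W (e i) z = lam i * e i z}.

End eigenpairs.

Section coefficient.
Context d (T : measurableType d) (R : realType) (P : probability T R).

(* Applied to nonnegative z only, up to null events. *)
Definition cutoff (B z : R) : R := Num.min z B.

Definition coef_K (abar : R * R -> R) (Phi1 Phi2 : R -> R)
    (W1 W2 : R * R -> {RV P >-> R}) (l1 l2 : R -> {RV P >-> R})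
    (K : R) (w : T) (z : R * R) : R :=
  abar z + Phi1 (W1 z w) +
  Phi2 (W2 (cutoff K (l1 z.1 w), cutoff K (l2 z.2 w)) w).

Definition coef_KA (abar : R * R -> R) (Phi1 Phi2 : R -> R)
    (W1 W2 : R * R -> {RV P >-> R}) (l1 l2 : R -> {RV P >-> R})
    (K A : R) (w : T) (z : R * R) : R :=
  cutoff A (coef_K abar Phi1 Phi2 W1 W2 l1 l2 K w z).

End coefficient.

(* Main.v *)
From HB Require Import structures.
Require Import Defs.
From mathcomp Require Import all_boot all_order all_algebra.
From mathcomp Require Import all_classical all_reals all_analysis ess_sup_inf.
From mathcomp Require Import measurable_realfun ring lra.

Set Implicit Arguments.
Unset Strict Implicit.
Unset Printing Implicit Defensive.

Import Order.TTheory GRing.Theory Num.Theory.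
Import numFieldNormedType.Exports.

Local Open Scope classical_set_scope.
Local Open Scope ring_scope.

(** The coefficient is dominated path by path. On an event of full probability
    the cut off subordinators take values in [0, K], so that a_K depends on W1
    and W2 only through their values on compact squares, and the growth
    conditions on Phi1 and Phi2 bound it at all points at once by a constant
    times exp (kappa sup |W1|) + exp (kappa sup |W2|), with kappa = psi + 1. All
    exponential moments of these suprema are finite
    ([field_exponential_majorant]), and therefore all moments of the bound are
    ([coef_K_majorant]), which is the first claim. For the second,
    |a_K - min (a_K, A)| <= a_K^2 / A ([cutoff_error_powR]), so that the error in
    the n-th mean is of order 1 / A. The essential supremum need not be a
    measurable function of omega; this is harmless because only upper bounds of
    its integral are required ([integral_le_ae_majorant]).

    The exponential moments come from chaining over dyadic grids
    ([chaining_majorant]), which rests on the normality of single increments.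
    A path at z is the sum of its links, the increments between consecutive
    dyadic approximations of z. There are of order 4^k links at level k, with
    standard deviations at most of order r^k for some r < 1 ([link_mgf]). Hence
    Z = sum_k 8^-k sum exp (c1 |link| / r^k), the inner sum being over all links
    at level k, has finite expectation. Conversely, each link at level k is at
    most r^k (ln Z + k ln 8) / c1, and summing over k bounds c |W| by ln Z plus a
    constant, simultaneously on the whole square.

    The geometric decay is a Hoelder bound for the variance of increments
    ([field_increment_holder]), and this is where the eigenpairs enter. Continuity
    of the paths and normality make the covariance q continuous
    ([increment_variance_seq]). Being a limit of second moments of Riemann sums,
    the quadratic form of the covariance operator is nonnegative, and so are the
    eigenvalues ([cov_op_psd], [eigenvalue_ge0]). As the e_i form a basis,
    q (z, z') = sum_i lam_i e_i(z) e_i(z') at every pair of points ([mercer]), and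
    the variance of W z - W z' is sum_i lam_i (e_i(z) - e_i(z'))^2. Interpolation
    between the supremum and the Lipschitz bounds of e_i ([sqr_interpolation],
    [C1_csquare_lipschitz]) turns the summability of lam_i i^beta into the
    Hoelder bound. *)

(** * Exponential moments of normal variables *)

Section gaussian.
Context {R : realType}.
Local Notation mu := (@lebesgue_measure R).

(** Uniqueness of Radon-Nikodym derivatives identifies the abstract one of the
    normal law with its density. *)
Lemma integral_normal_prob (m s : R) (f : R -> \bar R) :
  measurable_fun setT f -> (forall x, 0 <= f x)%E ->
  (\int[normal_prob m s]_x f x = \int[mu]_x (f x * (normal_pdf m s x)%:E))%E.
Proof.
move=> mf f0.
rewrite -(Radon_Nikodym_SigmaFinite.change_of_variables
  (normal_prob_dominates m s) f0 measurableT mf).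
have ipdf := integrable_normal_pdf m s.
have irn := Radon_Nikodym_SigmaFinite.f_integrable (normal_prob_dominates m s).
apply: ge0_ae_eq_integral => //.
- by apply: emeasurable_funM => //; exact: measurable_int irn.
- by apply: emeasurable_funM => //; exact: measurable_int ipdf.
- move=> x _; apply: mule_ge0 => //; apply: Radon_Nikodym_SigmaFinite.f_ge0.
  exact: normal_prob_dominates.
- by move=> x _; rewrite mule_ge0 ?lee_fin ?normal_pdf_ge0.
have : ae_eq mu setT (Radon_Nikodym_SigmaFinite.f (normal_prob m s) mu)
    (fun x => (normal_pdf m s x)%:E).
  apply: integral_ae_eq => //; first exact: measurable_int ipdf.
  move=> A AT mA; rewrite -Radon_Nikodym_SigmaFinite.f_integral//.
  exact: normal_prob_dominates.
by apply: filterS => x /= h xT; rewrite h.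
Qed.

(** The exponential tilt of a normal density is again a normal density. *)
Lemma expR_normal_pdf (m s t x : R) : s != 0 ->
  expR (t * x) * normal_pdf m s x =
  expR (t * m + t ^+ 2 * s ^+ 2 / 2) * normal_pdf (m + t * s ^+ 2) s x.
Proof.
move=> s0; rewrite !normal_pdfE//= !(mulrCA (expR _)); congr (_ * _).
rewrite /normal_fun -!expRD; congr expR.
rewrite -mulr_natr; field.
by rewrite s0.
Qed.

Lemma integral_expR_normal_prob (m s t : R) : s != 0 ->
  (\int[normal_prob m s]_x (expR (t * x))%:E =
   (expR (t * m + t ^+ 2 * s ^+ 2 / 2))%:E)%E.
Proof.
move=> s0; rewrite integral_normal_prob//; last first.
  by apply/measurable_EFinP; apply: measurableT_comp => //.
under eq_integral do rewrite -EFinM expR_normal_pdf// EFinM.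
rewrite ge0_integralZl//.
- by rewrite integral_normal_pdf mule1.
- by apply/measurable_EFinP; exact: measurable_normal_pdf.
- by move=> x _; rewrite lee_fin normal_pdf_ge0.
Qed.

End gaussian.

Section gaussian_rv.
Context d (T : measurableType d) (R : realType) (P : probability T R).
Implicit Types X : T -> R.

Lemma ge0_le_integral_fin (D : set T) (f g : T -> R) : measurable D ->
  measurable_fun D f -> measurable_fun D g ->
  (forall x, D x -> 0 <= f x <= g x) ->
  (\int[P]_(x in D) (f x)%:E <= \int[P]_(x in D) (g x)%:E)%E.
Proof.
move=> mD mf mg fg; apply: ge0_le_integral => //.
- by move=> x /fg/andP[]; rewrite lee_fin.
- exact/measurable_EFinP.
- exact/measurable_EFinP.
- by move=> x /fg/andP[]; rewrite lee_fin.
Qed.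

(** The condition in [gaussian_rv], with the two parameters of the law made
    explicit. *)
Definition has_gaussian_law X (m s : R) := forall B : set R, measurable B ->
  P (X @^-1` B) = if s == 0 then \d_m B else normal_prob m s B.

Lemma ge0_integral_gaussian_law X m s (f : R -> R) :
  measurable_fun setT X -> has_gaussian_law X m s ->
  measurable_fun setT f -> (forall x, 0 <= f x) ->
  (\int[P]_w (f (X w))%:E =
   if (s == 0)%R then (f m)%:E else \int[normal_prob m s]_x (f x)%:E)%E.
Proof.
move=> mX lawX mf f0.
have mf' : measurable_fun setT (EFin \o f) by exact/measurable_EFinP.
(* [normal_prob] is a measure on [measurableTypeR R], whose display is not that
   of the canonical measurable structure of R. *)
have mX' : measurable_fun setT (X : T -> measurableTypeR R) by [].
pose X' : {mfun T >-> measurableTypeR R} :=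
  HB.pack (X : T -> measurableTypeR R) (isMeasurableFun.Build _ _ _ _ _ mX').
transitivity (\int[distribution P X']_y (f y)%:E)%E.
  by rewrite ge0_integral_distribution// => x; rewrite lee_fin.
case: ifPn lawX => [s0|s0] lawX.
  rewrite (@eq_measure_integral _ _ _ _ (\d_(m : measurableTypeR R))).
    by rewrite integral_dirac// diracT mul1e.
  by move=> A mA _; have := lawX A mA; rewrite s0.
apply: eq_measure_integral => A mA _.
by have := lawX A mA; rewrite (negbTE s0).
Qed.

Lemma mgf_gaussian_law X m s t : measurable_fun setT X ->
  has_gaussian_law X m s ->
  (\int[P]_w (expR (t * X w))%:E =
   (expR (t * m + t ^+ 2 * s ^+ 2 / 2))%:E)%E.
Proof.
move=> mX lawX.
rewrite (@ge0_integral_gaussian_law X m s (fun x => expR (t * x)))//; last first.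
  exact: measurableT_comp.
have [->|s0] := eqVneq s 0; first by rewrite expr0n/= mulr0 mul0r addr0.
exact: integral_expR_normal_prob.
Qed.

Lemma gaussian_law_integrable X m s : measurable_fun setT X ->
  has_gaussian_law X m s -> P.-integrable setT (EFin \o X).
Proof.
move=> mX lawX.
have mgf t : P.-integrable setT (fun w => (expR (t * X w))%:E).
  apply/integrableP; split.
    by apply/measurable_EFinP; apply: measurableT_comp => //; exact: measurable_funM.
  under eq_integral do rewrite gee0_abs ?lee_fin ?expR_ge0//.
  by rewrite (mgf_gaussian_law _ mX lawX) ltry.
have := integrableD measurableT (mgf 1) (mgf (-1)).
apply: le_integrable => //; first exact/measurable_EFinP.
move=> w _ /=; rewrite lee_fin mul1r mulN1r [leRHS]ger0_norm ?addr_ge0 ?expR_ge0//.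
have := expR_ge1Dx (X w); have := expR_ge1Dx (- X w).
have := expR_ge0 (X w); have := expR_ge0 (- X w).
by rewrite ler_norml; lra.
Qed.

(** By Jensen's inequality the moment generating function of a centred variable
    is at least 1; for N(m, s) this forces m to vanish. *)
Lemma gaussian_law_centered X m s : measurable_fun setT X ->
  has_gaussian_law X m s -> ('E_P[X] = 0)%E -> m = 0.
Proof.
move=> mX lawX EX0.
have iX := gaussian_law_integrable mX lawX.
have ge1 t : 0 <= t * m + t ^+ 2 * s ^+ 2 / 2.
  rewrite -ler_expR expR0.
  rewrite -lee_fin -(mgf_gaussian_law t mX lawX).
  have -> : (1%:E = \int[P]_w (1 + t * X w)%:E :> \bar R)%E.
    rewrite (eq_integral (fun w => (1%:E + t%:E * (X w)%:E)%E)).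
      rewrite integralD//=.
      - rewrite integral_cst//= probability_setT mul1e integralZl//.
        by move: EX0; rewrite unlock => ->; rewrite mule0 adde0.
      - exact: finite_measure_integrable_cst.
      - exact: integrableZl.
    by move=> w _; rewrite EFinD EFinM.
  apply: le_integral => //.
  - apply: (eq_integrable _ (fun w => (1%:E + t%:E * (X w)%:E)%E)) => //.
    apply: integrableD => //; first exact: finite_measure_integrable_cst.
    exact: integrableZl.
  - apply/integrableP; split.
      by apply/measurable_EFinP; apply: measurableT_comp => //; exact: measurable_funM.
    under eq_integral do rewrite gee0_abs ?lee_fin ?expR_ge0//.
    by rewrite (mgf_gaussian_law _ mX lawX) ltry.
  - by move=> w _; rewrite lee_fin expR_ge1Dx.
have [s0|s0] := eqVneq s 0.
  by have := ge1 (- m); rewrite s0; nra.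
have s2 : 0 < s ^+ 2 by rewrite exprn_even_gt0.
(* the minimiser of t m + t^2 s^2 / 2 *)
have := ge1 (- m / s ^+ 2).
have -> : - m / s ^+ 2 * m + (- m / s ^+ 2) ^+ 2 * s ^+ 2 / 2
  = - (m ^+ 2 / s ^+ 2 / 2) by field; rewrite s0.
rewrite oppr_ge0 pmulr_lle0 ?invr_gt0// pmulr_lle0 ?invr_gt0// => m2.
by apply/eqP; rewrite -sqrf_eq0 eq_le m2 sqr_ge0.
Qed.

End gaussian_rv.

Section gaussian_moments.
Context d (T : measurableType d) (R : realType) (P : probability T R).
Implicit Types X : T -> R.

(** A normal density of parameter s is bounded by 1 / (sqrt (2 pi) |s|), so that
    the mass it gives to an interval of length |s| is at most 1 / 2. *)
Lemma gaussian_law_small_ball X (s : R) : s != 0 -> has_gaussian_law P X 0 s ->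
  (P [set w | (`|X w| <= `|s| / 2)%R] <= (2^-1)%:E)%E.
Proof.
move=> s0 lawX; have s_gt0 : 0 < `|s| by rewrite normr_gt0.
have -> : [set w | `|X w| <= `|s| / 2] = X @^-1` `[- (`|s| / 2), `|s| / 2].
  by apply/seteqP; split => w /=; rewrite in_itv/= ler_norml.
rewrite lawX// (negbTE s0) /normal_prob.
pose I : set (measurableTypeR R) := `[- (`|s| / 2), `|s| / 2]%classic.
have peak : (\int[lebesgue_measure]_(x in I) (normal_pdf 0 s x)%:E <=
    \int[lebesgue_measure]_(x in I) (normal_peak s)%:E)%E.
  apply: ge0_le_integral => //.
  - exact: measurable_itv.
  - by move=> x _; rewrite lee_fin normal_pdf_ge0.
  - apply/measurable_EFinP; apply: measurable_funTS.
    exact: measurable_normal_pdf.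
  - by move=> x _; rewrite lee_fin normal_pdf_ub.
apply: (le_trans peak).
rewrite integral_cst /I/= ?lebesgue_measure_itv/= ?lte_fin; last exact: measurable_itv.
have -> : - (`|s| / 2) < `|s| / 2 by lra.
rewrite -EFinD -EFinM lee_fin opprK -mulrDl -mulr2n -(mulr_natr `|s|) mulfK//.
rewrite /normal_peak -mulr_natr -mulrA sqrtrM ?sqr_ge0// sqrtr_sqr invfM.
rewrite mulrAC mulVf ?gt_eqF// mul1r lef_pV2 ?posrE ?sqrtr_gt0//; last first.
  by rewrite mulr_gt0// pi_gt0.
rewrite -[leLHS]ger0_norm// -sqrtr_sqr ler_wsqrtr// expr2 ler_pM2r//.
exact: pi_ge2.
Qed.

Lemma sqr_le_expR_norm (x : R) : x ^+ 2 <= 4 * (expR x + expR (- x)).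
Proof.
wlog x0 : x / 0 <= x.
  move=> h; have [/h//|/ltW x0] := leP 0 x.
  by have := h (- x); rewrite sqrrN opprK addrC oppr_ge0; apply.
(* x^2 <= 4 (1 + x / 2)^2 <= 4 exp x for x >= 0 *)
have := expR_ge1Dx (x / 2); have := expR_ge0 (- x).
have -> : expR x = expR (x / 2) ^+ 2.
  by rewrite expr2 -expRD; congr expR; field.
by nra.
Qed.

Lemma expR_norm_le (x : R) : expR `|x| <= expR x + expR (- x).
Proof.
by case: (ger0P x) => _; rewrite (lerDl, lerDr) expR_ge0.
Qed.

Lemma measurable_norm_le X c : measurable_fun setT X ->
  measurable [set w | `|X w| <= c].
Proof.
move=> mX; rewrite -[X in measurable X]setTI.
apply: measurable_fun_le => //; exact: measurableT_comp.
Qed.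

Lemma measurable_sqr X : measurable_fun setT X ->
  measurable_fun setT (fun w => X w ^+ 2).
Proof. by move=> mX; exact: measurable_funX. Qed.

Lemma measurable_expRM X t : measurable_fun setT X ->
  measurable_fun setT (fun w => expR (t * X w)).
Proof.
by move=> mX; apply: measurableT_comp => //; exact: measurable_funM.
Qed.

(** Squares are dominated by exponentials, whose means at the scale 1 / s are
    absolute constants. *)
Lemma gaussian_law_second_moment_le X s : measurable_fun setT X ->
  has_gaussian_law P X 0 s ->
  (\int[P]_w (X w ^+ 2)%:E <= (16 * s ^+ 2)%:E)%E.
Proof.
move=> mX lawX; have [s0|s0] := eqVneq s 0.
  rewrite (@ge0_integral_gaussian_law _ _ _ P X 0 s (fun x => x ^+ 2))//.
    by rewrite s0 eqxx lee_fin expr0n/= mulr0.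
  by move=> x; rewrite sqr_ge0.
have s2 : 0 < s ^+ 2 by rewrite exprn_even_gt0.
apply: (@le_trans _ _ (\int[P]_w ((4 * s ^+ 2)%:E *
    ((expR (s^-1 * X w))%:E + (expR (- s^-1 * X w))%:E)))%E).
  under [leRHS]eq_integral do rewrite -EFinD -EFinM.
  apply: ge0_le_integral_fin => //.
  - exact: measurable_sqr.
  - apply: measurable_funM => //; apply: measurable_funD; exact: measurable_expRM.
  - move=> w _; rewrite sqr_ge0/=.
    have := sqr_le_expR_norm (s^-1 * X w).
    rewrite exprMn exprVn -ler_pdivlMl ?invr_gt0// invrK mulNr => /le_trans; apply.
    by rewrite mulrCA mulrA.
rewrite ge0_integralZl//.
- rewrite ge0_integralD//.
  + rewrite !(mgf_gaussian_law _ mX lawX) -EFinD -EFinM lee_fin !mulr0 !add0r sqrrN.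
    rewrite exprVn mulVf ?gt_eqF//.
    have e : expR (1 / 2 : R) <= 2.
      have := expR_ge1Dx (- (1 / 2) : R); rewrite expRN => h.
      move: h; rewrite -(ler_pM2l (expR_gt0 (1 / 2 : R))) mulfV ?gt_eqF ?expR_gt0//.
      by lra.
    by nra.
  + by apply/measurable_EFinP; exact: measurable_expRM.
  + by apply/measurable_EFinP; exact: measurable_expRM.
- apply: emeasurable_funD; apply/measurable_EFinP; exact: measurable_expRM.
- by move=> w _; rewrite adde_ge0// lee_fin expR_ge0.
- by rewrite lee_fin; nra.
Qed.

(** By [gaussian_law_small_ball], X^2 exceeds s^2 / 4 with probability at
    least 1 / 2. *)
Lemma gaussian_law_second_moment_ge X s : measurable_fun setT X ->
  has_gaussian_law P X 0 s ->
  ((s ^+ 2 / 8)%:E <= \int[P]_w (X w ^+ 2)%:E)%E.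
Proof.
move=> mX lawX; have [->|s0] := eqVneq s 0.
  by rewrite expr0n/= mul0r integral_ge0// => w _; rewrite lee_fin sqr_ge0.
have s2 : 0 < s ^+ 2 by rewrite exprn_even_gt0.
pose A := [set w | `|X w| <= `|s| / 2].
have mA : measurable A by exact: measurable_norm_le.
apply: (@le_trans _ _ (\int[P]_(w in ~` A) (s ^+ 2 / 4)%:E)%E).
  rewrite integral_cst; last exact: measurableC.
  rewrite [X in (_ * X)%E](_ : _ = (1 - P A)%E); last exact: probability_setC.
  have := gaussian_law_small_ball s0 lawX; rewrite -/A.
  rewrite -(fineK (fin_num_measure P _ mA)) lee_fin => h.
  by rewrite -EFinB -EFinM lee_fin; nra.
apply: (@le_trans _ _ (\int[P]_(w in ~` A) (X w ^+ 2)%:E)%E).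
  apply: ge0_le_integral_fin => //; first exact: measurableC.
  - by apply: measurable_funTS; exact: measurable_sqr.
  - move=> w /=; rewrite /A/= => /negP; rewrite -ltNge => h.
    apply/andP; split; first lra.
    rewrite -(real_normK (num_real (X w))) -(real_normK (num_real s)).
    by have := normr_ge0 s; nra.
apply: ge0_subset_integral => //; first exact: measurableC.
- by apply/measurable_EFinP; exact: measurable_sqr.
- by move=> w _; rewrite lee_fin sqr_ge0.
Qed.

(** Everything that is used about normal variables, in terms of the variance
    v: it is finite, the mass near 0 on the scale sqrt v is bounded away from
    1, and exponential moments grow at most like those of a normal law. *)
Lemma centered_gaussian_rv X : measurable_fun setT X -> gaussian_rv P X ->
  ('E_P[X] = 0)%E -> let v := \int[P]_w (X w ^+ 2) in
  [/\ P.-integrable setT (fun w => (X w ^+ 2)%:E),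
      0 < v -> (P [set w | (`|X w| <= Num.sqrt v / 8)%R] <= (2^-1)%:E)%E &
      forall t, (\int[P]_w (expR (t * `|X w|))%:E <=
                 (2 * expR (4 * t ^+ 2 * v))%:E)%E].
Proof.
move=> mX [m [s lawX]] EX0 v.
have m0 := gaussian_law_centered mX lawX EX0; subst m.
have i2 : P.-integrable setT (fun w => (X w ^+ 2)%:E).
  apply/integrableP; split.
    by apply/measurable_EFinP; exact: measurable_sqr.
  under eq_integral do rewrite gee0_abs ?lee_fin ?sqr_ge0//.
  by rewrite (le_lt_trans (gaussian_law_second_moment_le mX lawX))// ltry.
have vE : (v%:E = \int[P]_w (X w ^+ 2)%:E)%E.
  by rewrite /v /Rintegral fineK// integrable_fin_num.
have := gaussian_law_second_moment_le mX lawX; rewrite -vE lee_fin => v_le.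
have := gaussian_law_second_moment_ge mX lawX; rewrite -vE lee_fin => v_ge.
split => //.
- move=> v0; have s0 : s != 0.
    by apply: contraTneq v0 => s0; rewrite -leNgt (le_trans v_le)// s0 expr0n/= mulr0.
  apply: le_trans (gaussian_law_small_ball s0 lawX).
  apply: le_measure; rewrite ?inE; [exact: measurable_norm_le..|]; move=> w /= /le_trans; apply.
  have : Num.sqrt v <= Num.sqrt ((4 * `|s|) ^+ 2).
    by rewrite ler_wsqrtr// exprMn real_normK ?num_real//; lra.
  by rewrite sqrtr_sqr normrM normr_id ger0_norm//; lra.
- move=> t.
  apply: (@le_trans _ _ (\int[P]_w ((expR (t * X w))%:E + (expR (- t * X w))%:E))%E).
    under [leRHS]eq_integral do rewrite -EFinD.
    apply: ge0_le_integral_fin => //.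
    + by apply: measurable_expRM; exact: measurableT_comp.
    + by apply: measurable_funD; exact: measurable_expRM.
    + move=> w _; rewrite expR_ge0/= mulNr (le_trans _ (expR_norm_le _))//.
      by rewrite ler_expR normrM ler_wpM2r// ler_norm.
  rewrite ge0_integralD//.
  + rewrite !(mgf_gaussian_law _ mX lawX) -EFinD lee_fin !mulr0 !add0r sqrrN -mulr2n.
    rewrite -[leLHS]mulr_natl ler_pM2l// ler_expR.
    by have := sqr_ge0 t; nra.
  + by apply/measurable_EFinP; exact: measurable_expRM.
  + by apply/measurable_EFinP; exact: measurable_expRM.
Qed.

End gaussian_moments.

(** * Dyadic grids and Riemann sums on the square *)

Section dyadic_rounding.
Context {R : realType}.
Implicit Types (b x : R) (m i : nat).

Definition grid b m i : R := b * i%:R / 2 ^+ m.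

Definition grid_index b m x : nat := Num.truncn (2 ^+ m * x / b).

Definition grid_point b m (i j : nat) : R * R := (grid b m i, grid b m j).

Definition grid_round b m (z : R * R) : R * R :=
  grid_point b m (grid_index b m z.1) (grid_index b m z.2).

Lemma grid_index_le b m x : 0 < b -> x <= b -> (grid_index b m x <= 2 ^ m)%N.
Proof.
move=> b0 xb; rewrite truncn_le_nat.
rewrite (@le_lt_trans _ _ (2 ^ m)%:R) ?ltr_nat// ler_pdivrMr// natrX.
by rewrite ler_wpM2l ?exprn_ge0.
Qed.

Lemma grid_index_eq b m x i : 0 < b -> 0 <= x ->
  (grid_index b m x == i) = (grid b m i <= x < grid b m i.+1).
Proof.
move=> b0 x0; have p : 0 < 2 ^+ m :> R by rewrite exprn_gt0.
rewrite /grid_index truncn_eq; last by rewrite divr_ge0 ?mulr_ge0 ?(ltW p) ?(ltW b0).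
rewrite /grid ler_pdivlMr// ltr_pdivrMr// ler_pdivrMr// ltr_pdivlMr//.
by rewrite !(mulrC b) (mulrC x).
Qed.

(** Rounding down is compatible between consecutive levels; this makes the
    increments along the dyadic approximations of a point telescope. *)
Lemma grid_index_half b m x : 0 < b -> 0 <= x ->
  grid_index b m x = (grid_index b m.+1 x)./2.
Proof.
move=> b0 x0; apply/eqP; rewrite grid_index_eq//.
have := grid_index_eq m.+1 (grid_index b m.+1 x) b0 x0; rewrite eqxx => /esym.
set k := grid_index _ _ _ => /andP[k1 k2].
have p : 0 < 2 ^+ m :> R by rewrite exprn_gt0.
have e i : grid b m i = grid b m.+1 i.*2.
  rewrite /grid exprS -mul2n natrM; field.
  by rewrite gt_eqF.
have mono i j : (i <= j)%N -> grid b m.+1 i <= grid b m.+1 j.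
  move=> ij; rewrite /grid ler_pM2r ?invr_gt0 ?exprn_gt0//.
  by rewrite ler_pM2l// ler_nat.
rewrite !e (le_trans _ k1)/= ?(lt_le_trans k2)//; apply: mono.
- by rewrite doubleS ltnS -[leqLHS]odd_double_half; case: (odd k); rewrite ?leqnSn.
- by rewrite -[leqRHS]odd_double_half leq_addl.
Qed.

Lemma grid_round_itv b m x : 0 < b -> 0 <= x <= b ->
  0 <= grid b m (grid_index b m x) <= x /\
  x - grid b m (grid_index b m x) < b / 2 ^+ m.
Proof.
move=> b0 /andP[x0 xb].
have := grid_index_eq m (grid_index b m x) b0 x0; rewrite eqxx => /esym/andP[k1 k2].
split; first by rewrite k1 andbT /grid divr_ge0 ?mulr_ge0 ?exprn_ge0 ?(ltW b0).
rewrite ltrBlDl (lt_le_trans k2)// /grid -[in leLHS]natr1 mulrDr mulr1 mulrDl.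
by rewrite lexx.
Qed.

Lemma grid_round_csquare b m z : 0 < b -> csquare b z ->
  csquare b (grid_round b m z).
Proof.
move=> b0 [/=]; rewrite !in_itv/= => h1 h2.
have [/andP[p1 q1] _] := grid_round_itv m b0 h1.
have [/andP[p2 q2] _] := grid_round_itv m b0 h2.
move: h1 h2 => /andP[_ h1] /andP[_ h2].
by split => /=; rewrite in_itv/= ?p1 ?p2/= ?(le_trans q1) ?(le_trans q2).
Qed.

Lemma grid_csquare b m i j : 0 < b -> (i <= 2 ^ m)%N -> (j <= 2 ^ m)%N ->
  csquare b (grid_point b m i j).
Proof.
move=> b0 im jm; have p : 0 < 2 ^+ m :> R by rewrite exprn_gt0.
have g k : (k <= 2 ^ m)%N -> 0 <= grid b m k <= b.
  move=> km; rewrite /grid divr_ge0 ?mulr_ge0 ?(ltW p) ?(ltW b0)//=.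
  by rewrite ler_pdivrMr// ler_pM2l// -natrX ler_nat.
by split => /=; rewrite in_itv/= g.
Qed.

Lemma cvg_grid b x : 0 < b -> 0 <= x <= b ->
  grid b m (grid_index b m x) @[m --> \oo] --> x.
Proof.
move=> b0 xb; apply/cvgrPdist_lt => e e0.
have h0 : (b * 2^-1 ^+ m) @[m --> \oo] --> (0 : R).
  rewrite -[X in _ --> X](mulr0 b); apply: cvgMr; apply: cvg_expr.
  by rewrite ger0_norm// invf_lt1// ltr1n.
near=> m; have [/andP[k0 k1] k2] := grid_round_itv m b0 xb.
rewrite ger0_norm ?subr_ge0// (lt_trans k2)//.
apply: (@le_lt_trans _ _ `|0 - b * 2^-1 ^+ m|).
  by rewrite sub0r normrN exprVn ler_norm.
by near: m; move/cvgrPdist_lt : h0; exact.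
Unshelve. all: by end_near. Qed.

Lemma cvg_grid_round b z : 0 < b -> csquare b z ->
  grid_round b m z @[m --> \oo] --> within (csquare b) (nbhs z).
Proof.
move=> b0 Sz; have c : grid_round b m z @[m --> \oo] --> z.
  by case: z Sz => x y [/=]; rewrite !in_itv/= => hx hy;
    exact: (cvg_pair (cvg_grid b0 hx) (cvg_grid b0 hy)).
move=> A wA; have cA : \forall m \near \oo,
  csquare b (grid_round b m z) -> A (grid_round b m z) := c _ wA.
suff : \forall m \near \oo, A (grid_round b m z) by [].
by apply: filterS cA => m; apply; exact: grid_round_csquare.
Qed.

End dyadic_rounding.

Section finite_sums.
Context d (T : measurableType d) (R : realType).
Variables (mu : {measure set T -> \bar R}) (D : set T) (mD : measurable D).
Variables (I : Type) (f : I -> T -> R).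
Hypothesis intf : forall i, mu.-integrable D (EFin \o f i).

Lemma integrable_sum_fin (s : seq I) :
  mu.-integrable D (EFin \o (fun x => \sum_(i <- s) f i x)).
Proof.
elim: s => [|i s IH].
  rewrite (_ : _ \o _ = cst 0%E); first exact: integrable0.
  by apply/funext => x /=; rewrite big_nil.
rewrite (_ : _ \o _ = ((EFin \o f i) \+ (EFin \o (fun x => (\sum_(i <- s) f i x)%R)))%E).
  by apply: integrableD => //; exact: intf.
by apply/funext => x /=; rewrite big_cons EFinD.
Qed.

Lemma Rintegral_sum (s : seq I) :
  \int[mu]_(x in D) (\sum_(i <- s) f i x) = \sum_(i <- s) \int[mu]_(x in D) f i x.
Proof.
elim: s => [|i s IH].
  by under eq_Rintegral do rewrite big_nil; rewrite big_nil Rintegral_cst// mul0r.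
rewrite big_cons -IH -RintegralD//; last exact: integrable_sum_fin.
by apply: eq_Rintegral => x _; rewrite big_cons.
Qed.

End finite_sums.

Section square_integration.
Context {R : realType}.
Variable b : R.
Hypothesis b0 : 0 < b.
Local Notation S := (csquare b).
Local Notation mu := (@lebesgue_measure R \x @lebesgue_measure R)%E.

(** The filter form of continuity for the subspace topology, see
    [subspace_continuousP]; it composes with [cvg_grid_round]. *)
Definition continuous_on_csquare (f : R * R -> R) :=
  forall z, S z -> f @ within S (nbhs z) --> f z.

Lemma mu_csquare : mu S = (b ^+ 2)%:E.
Proof.
rewrite /csquare product_measure1E; try exact: measurable_itv.
rewrite /=.
by rewrite !lebesgue_measure_itv/= lte_fin b0 oppr0 !adde0 -EFinM expr2.
Qed.

Lemma mu_csquare_lty : (mu S < +oo)%E.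
Proof. by rewrite mu_csquare ltry. Qed.

Lemma measurable_csquare_prod : measurable (S : set (measurableTypeR R * measurableTypeR R)).
Proof. exact: measurable_csquare. Qed.

Lemma cvg_continuous_on_csquare f z : continuous_on_csquare f -> S z ->
  f (grid_round b m z) @[m --> \oo] --> f z.
Proof. by move=> cf Sz; apply: cvg_comp (cf _ Sz); exact: cvg_grid_round. Qed.

Definition grid_cell m (i j : nat) : set (measurableTypeR R * measurableTypeR R) :=
  (`[0, b] `&` `[grid b m i, grid b m i.+1[) `*`
  (`[0, b] `&` `[grid b m j, grid b m j.+1[).

Lemma measurable_grid_cell m i j : measurable (grid_cell m i j).
Proof. by apply: measurableX; apply: measurableI; exact: measurable_itv. Qed.

Lemma grid_cell_subset m i j : grid_cell m i j `<=` S.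
Proof. by move=> z [/= [? _] [? _]]. Qed.

Lemma grid_cellE m i j z : S z ->
  (z \in grid_cell m i j) =
  (grid_index b m z.1 == i) && (grid_index b m z.2 == j).
Proof.
move=> [/= z1 z2]; have := z1; have := z2; rewrite /= !in_itv/=.
move=> /andP[? _] /andP[? _]; rewrite !grid_index_eq//.
apply/idP/andP.
  by rewrite inE => -[/= [_ +] [_ +]]; rewrite /= !in_itv/=.
by move=> [h1 h2]; rewrite inE; split; split => //=; rewrite in_itv.
Qed.

Lemma grid_round_sum (g : R * R -> R) m z : S z ->
  g (grid_round b m z) =
  \sum_(i < (2 ^ m).+1) \sum_(j < (2 ^ m).+1)
     g (grid_point b m i j) * \1_(grid_cell m i j) z.
Proof.
move=> Sz; have := Sz => -[/=]; rewrite !in_itv/= => /andP[_ z1] /andP[_ z2].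
have k1 : (grid_index b m z.1 < (2 ^ m).+1)%N by rewrite ltnS grid_index_le.
have k2 : (grid_index b m z.2 < (2 ^ m).+1)%N by rewrite ltnS grid_index_le.
rewrite (bigD1 (Ordinal k1))//= [X in _ + X]big1 ?addr0; last first.
  move=> i ik; rewrite big1// => j _; rewrite indicE grid_cellE//.
  rewrite (_ : (_ == _ :> nat) = false) ?andbF ?mulr0//.
  by apply/negbTE; move: ik; rewrite -val_eqE/= eq_sym.
rewrite (bigD1 (Ordinal k2))//= [X in _ + X]big1 ?addr0; last first.
  move=> j jk; rewrite indicE grid_cellE// eqxx/=.
  rewrite (_ : (_ == _ :> nat) = false) ?andbF ?mulr0//.
  by apply/negbTE; move: jk; rewrite -val_eqE/= eq_sym.
by rewrite indicE grid_cellE// !eqxx mulr1.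
Qed.

Lemma measurable_grid_round (g : R * R -> R) m :
  measurable_fun S (fun z => g (grid_round b m z)).
Proof.
apply: (eq_measurable_fun (fun z => \sum_(i < (2 ^ m).+1)
  \sum_(j < (2 ^ m).+1) g (grid_point b m i j) * \1_(grid_cell m i j) z)).
  by move=> z; rewrite inE => Sz; rewrite -grid_round_sum.
apply: measurable_sum => i; apply: measurable_sum => j.
apply: measurable_funM => //; apply: measurable_funTS; apply: measurable_indic.
exact: measurable_grid_cell.
Qed.

(** A continuous function is the pointwise limit of its dyadic roundings,
    which are step functions. *)
Lemma measurable_continuous_on_csquare f : continuous_on_csquare f ->
  measurable_fun S f.
Proof.
move=> cf; apply: (measurable_fun_cvg (h := fun m z => f (grid_round b m z))).
  by move=> m; exact: measurable_grid_round.
by move=> z Sz; exact: cvg_continuous_on_csquare.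
Qed.

Lemma bounded_integrable_csquare (f : R * R -> R) M : measurable_fun S f ->
  (forall z, S z -> `|f z| <= M) -> mu.-integrable S (EFin \o f).
Proof.
move=> mf fM; apply: measurable_bounded_integrable => //.
- exact: measurable_csquare_prod.
- exact: mu_csquare_lty.
- exists M; split; first exact: num_real.
  by move=> x Mx z Sz; apply: (le_trans (fM z Sz)); exact: ltW.
Qed.

Lemma Rintegral_grid_round (g : R * R -> R) m :
  \int[mu]_(z in S) g (grid_round b m z) =
  \sum_(i < (2 ^ m).+1) \sum_(j < (2 ^ m).+1)
     g (grid_point b m i j) * fine (mu (grid_cell m i j)).
Proof.
under eq_Rintegral => z do rewrite inE => /grid_round_sum ->.
have icell i j : mu.-integrable S
    (fun z => (g (grid_point b m i j) * \1_(grid_cell m i j) z)%:E).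
  apply: (@bounded_integrable_csquare _ `|g (grid_point b m i j)|).
    apply: measurable_funM => //; apply: measurable_funTS.
    by apply: measurable_indic; exact: measurable_grid_cell.
  move=> z _; rewrite normrM ler_piMr// indicE.
  by case: (_ \in _); rewrite ?normr1// normr0.
rewrite Rintegral_sum; last 2 first.
- exact: measurable_csquare_prod.
- by move=> i; apply: integrable_sum_fin => [|j]; [exact: measurable_csquare_prod|exact: icell].
apply: eq_bigr => i _; rewrite Rintegral_sum; [|exact: measurable_csquare_prod|by move=> j; exact: icell].
apply: eq_bigr => j _; rewrite RintegralZl//; last 2 first.
- exact: measurable_csquare_prod.
- apply: (@bounded_integrable_csquare _ 1).
    by apply: measurable_funTS; apply: measurable_indic; exact: measurable_grid_cell.
  by move=> z _; rewrite indicE; case: (_ \in _); rewrite ?normr1// normr0.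
rewrite /Rintegral integral_indic; last 2 first.
- exact: measurable_csquare_prod.
- exact: measurable_grid_cell.
by rewrite setIidl//; exact: grid_cell_subset.
Qed.

Lemma bounded_cvg_csquare (f_ : nat -> R * R -> R) (f : R * R -> R) (M : R) :
  (forall m, measurable_fun S (f_ m)) ->
  (forall m z, S z -> `|f_ m z| <= M) ->
  (forall z, S z -> f_ m z @[m --> \oo] --> f z) ->
  \int[mu]_(z in S) f_ m z @[m --> \oo] --> \int[mu]_(z in S) f z.
Proof.
move=> mf fM f_f.
have mf' : measurable_fun S f by exact: measurable_fun_cvg f_f.
have fM' z : S z -> `|f z| <= M.
  move=> Sz; have h : `|f_ m z| @[m --> \oo] --> `|f z|.
    by apply: cvg_norm; exact: f_f.
  rewrite -(cvg_lim _ h)//; apply: limr_le; first by apply/cvgP: h.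
  by apply: nearW => m; exact: fM.
have iM : mu.-integrable S (cst M%:E).
  apply: (@bounded_integrable_csquare (cst M) `|M|) => //.
have cE z : S z -> (f_ m z)%:E @[m --> \oo] --> (f z)%:E.
  by move=> Sz; apply: cvg_EFin; [exact: nearW|exact: f_f].
have [|||||_ _ h] := @dominated_convergence _
  (measurableTypeR R * measurableTypeR R)%type R mu S measurable_csquare_prod
  (fun m z => (f_ m z)%:E) (fun z => (f z)%:E) (cst M%:E).
- by move=> m; apply/measurable_EFinP; exact: mf.
- by apply/measurable_EFinP; exact: mf'.
- by apply: aeW => z; exact: cE.
- exact: iM.
- by apply: aeW => z n Sz; rewrite lee_fin; exact: fM.
have fin (g : R * R -> R) : measurable_fun S g -> (forall z, S z -> `|g z| <= M) ->
    (\int[mu]_(z in S) (g z)%:E)%E \is a fin_num.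
  move=> mg gM; apply: integrable_fin_num; first exact: measurable_csquare_prod.
  exact: bounded_integrable_csquare gM.
apply: fine_cvg; rewrite /Rintegral fineK; last exact: fin.
exact: h.
Qed.

End square_integration.

(** * Full measure and density in the square *)

Lemma osquare_csquare (R : realType) (b : R) z : osquare b z -> csquare b z.
Proof.
move=> [/=]; rewrite !in_itv/= => /andP[? ?] /andP[? ?].
by split; rewrite /= in_itv/=; apply/andP; split; exact: ltW.
Qed.

Section density.
Context {R : realType}.
Variable b : R.
Hypothesis b0 : 0 < b.
Local Notation S := (csquare b).
Local Notation mu := (@lebesgue_measure R \x @lebesgue_measure R)%E.

Lemma ae_weaken (Q1 Q2 : R * R -> Prop) : (forall z, Q1 z -> Q2 z) ->
  {ae mu, forall z, Q1 z} -> {ae mu, forall z, Q2 z}.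
Proof.
move=> Q12 [N [mN N0 h]]; exists N; split => //; apply: subset_trans h.
by apply: subsetC => z /Q12.
Qed.

Lemma itv_near (x eps : R) : 0 < eps -> 0 <= x <= b ->
  exists c d : R, [/\ c < d, 0 <= c, d <= b & forall y : R, c < y < d -> `|y - x| < eps].
Proof.
move=> e0 /andP[x0 xb].
exists (Num.max 0 (x - eps)), (Num.min b (x + eps)); split.
- by rewrite gt_max !lt_min b0/=; apply/and3P; split; lra.
- by rewrite le_max lexx.
- by rewrite ge_min lexx.
- move=> y; rewrite gt_max lt_min => /andP[/andP[_ h1] /andP[_ h2]].
  by rewrite ltr_norml; lra.
Qed.

(** Relatively open nonempty subsets of the closed square have positive
    measure, hence sets of full measure are dense in it. *)
Lemma csquare_near_pos z0 eps : S z0 -> 0 < eps ->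
  exists A : set (measurableTypeR R * measurableTypeR R),
  [/\ measurable A, (0 < mu A)%E, A `<=` osquare b &
      forall z, A z -> `|z.1 - z0.1| < eps /\ `|z.2 - z0.2| < eps].
Proof.
move=> [/=]; rewrite !in_itv/= => h1 h2 e0.
have [c1 [d1 [cd1 c10 d1b n1]]] := itv_near e0 h1.
have [c2 [d2 [cd2 c20 d2b n2]]] := itv_near e0 h2.
exists (`]c1, d1[ `*` `]c2, d2[); split.
- by apply: measurableX; exact: measurable_itv.
- rewrite product_measure1E; try exact: measurable_itv.
  rewrite /= !lebesgue_measure_itv/= !lte_fin cd1 cd2.
  by rewrite -!EFinD -EFinM lte_fin mulr_gt0// subr_gt0.
- move=> z [/=]; rewrite !in_itv/= => /andP[? ?] /andP[? ?].
  by split; rewrite /= in_itv/=; lra.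
- by move=> z [/=]; rewrite !in_itv/= => /n1 ? /n2.
Qed.

Lemma ae_csquare_dense (Q : R * R -> Prop) z0 eps :
  {ae mu, forall z, S z -> Q z} -> S z0 -> 0 < eps ->
  exists z, [/\ osquare b z, Q z, `|z.1 - z0.1| < eps & `|z.2 - z0.2| < eps].
Proof.
move=> [N [mN N0 QN]] Sz0 e0.
have [A [mA A0 AS nA]] := csquare_near_pos Sz0 e0.
have [z [Az Nz]] : exists z, A z /\ ~ N z.
  apply: contrapT => h; have AN : A `<=` N.
    by move=> z Az; apply: contrapT => Nz; apply: h; exists z.
  have : (mu A <= mu N)%E by apply: le_measure => //; rewrite inE.
  by rewrite N0 leNgt A0.
have Qz : osquare b z -> Q z.
  move=> oz; apply: contrapT => nq; apply: Nz; apply: QN => /= h; apply: nq.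
  by apply: h; exact: osquare_csquare.
by exists z; have [? ?] := nA _ Az; split => //; [exact: AS|apply: Qz; exact: AS].
Qed.

Lemma nbhs_box (z0 : R * R) (A : set (R * R)) : nbhs z0 A ->
  exists2 eps, 0 < eps & forall z, `|z.1 - z0.1| < eps -> `|z.2 - z0.2| < eps -> A z.
Proof.
move=> /nbhs_ballP[e e0 h]; exists e => // z z1 z2; apply: h.
by split => /=; rewrite /ball/= distrC.
Qed.

Lemma ae_csquare_within (Q : R * R -> Prop) z0 (A : set (R * R)) :
  {ae mu, forall z, S z -> Q z} -> S z0 -> within S (nbhs z0) A ->
  exists z, [/\ osquare b z, Q z & A z].
Proof.
move=> aeQ Sz0 wA; have [e e0 h] := nbhs_box wA.
have [z [oz Qz z1 z2]] := ae_csquare_dense aeQ Sz0 e0.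
by exists z; split => //; apply: h => //; exact: osquare_csquare.
Qed.

Lemma ae_le_csquare (f : R * R -> R) (c : R) : continuous_on_csquare b f ->
  {ae mu, forall z, S z -> f z <= c} -> forall z, S z -> f z <= c.
Proof.
move=> cf aef z Sz; rewrite leNgt; apply/negP => cfz.
have [z' [_ h1 h2]] := ae_csquare_within (A := [set z | c < f z]) aef Sz
  (cvgr_gt _ (cf z Sz) _ cfz).
by move: h2; rewrite /= ltNge h1.
Qed.

Lemma ae_eq_csquare (f g : R * R -> R) :
  continuous_on_csquare b f -> continuous_on_csquare b g ->
  {ae mu, forall z, S z -> f z = g z} -> forall z, S z -> f z = g z.
Proof.
move=> cf cg aefg z Sz; apply/eqP; rewrite -subr_eq0 -normr_le0.
apply: (@ae_le_csquare (fun z => `|f z - g z|)) Sz.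
  by move=> w Sw; apply: cvg_norm; apply: cvgB; [exact: cf|exact: cg].
by apply: ae_weaken aefg => w h /h ->; rewrite subrr normr0.
Qed.

Lemma ae_mrestr (Q : R * R -> Prop) :
  {ae mrestr mu (measurable_csquare b), forall z, Q z} ->
  {ae mu, forall z, S z -> Q z}.
Proof.
move=> [N [mN N0 QN]]; exists (N `&` S); split.
- by apply: measurableI => //; exact: measurable_csquare_prod.
- exact: N0.
- move=> z /= h; have Sz : S z by apply: contrapT => h'; apply: h.
  by split => //; apply: QN => /= Qz; apply: h.
Qed.

Lemma Linfty_norm_le (f : R * R -> R) (c : R) : (Linfty_norm b f <= c%:E)%E ->
  {ae mu, forall z, S z -> `|f z| <= c}.
Proof.
move=> h; apply: ae_mrestr; move: h; rewrite /Linfty_norm unlock /Lnorm/=.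
have -> : (0 < mrestr mu (measurable_csquare b) [set: _])%E.
  rewrite /mrestr setTI mu_csquare// lte_fin exprn_gt0//.
move=> /ess_supP; apply: filterS => z /=.
by rewrite lee_fin.
Qed.

End density.

(** * Lipschitz continuity of the eigenfunctions *)

Section lipschitz.
Context {R : realType}.
Variable b : R.
Hypothesis b0 : 0 < b.
Local Notation S := (csquare b).
Local Notation mu := (@lebesgue_measure R \x @lebesgue_measure R)%E.

Lemma within_continuous_on_csquare (f : R * R -> R) :
  {within S, continuous f} -> continuous_on_csquare b f.
Proof. by move=> /subspace_continuousP. Qed.

Lemma osquare_dense_le (f : R * R -> R) (c : R) : continuous_on_csquare b f ->
  (forall z, osquare b z -> f z <= c) -> forall z, S z -> f z <= c.
Proof.
move=> cf fc z Sz; rewrite leNgt; apply/negP => cfz.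
have T : {ae mu, forall z, S z -> True} by exact: aeW.
have [z' [oz _]] := ae_csquare_within b0 (A := [set z | c < f z]) T Sz
  (cvgr_gt _ (cf z Sz) _ cfz).
by rewrite /= ltNge fc.
Qed.

Lemma Linfty_norm_le_csquare (f : R * R -> R) (c : R) :
  {within S, continuous f} -> (Linfty_norm b f <= c%:E)%E ->
  forall z, S z -> `|f z| <= c.
Proof.
move=> /within_continuous_on_csquare cf /(Linfty_norm_le b0).
by apply: ae_le_csquare => // z Sz; apply: cvg_norm; exact: cf.
Qed.

(** The bound on the gradient holds almost everywhere and inside the open
    square; continuity of the extended partial derivatives carries it to all
    points of the closed square. *)
Lemma partial_derivative_bound (f g1 g2 : R * R -> R) (L : R) :
  {within S, continuous g1} -> {within S, continuous g2} ->
  (forall z, osquare b z -> 'D_(1, 0) f z = g1 z /\ 'D_(0, 1) f z = g2 z) ->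
  (Linfty_norm b (grad_norm f) <= L%:E)%E ->
  forall z, S z -> `|g1 z| <= L /\ `|g2 z| <= L.
Proof.
move=> c1 c2 gf /(Linfty_norm_le b0) fL.
have key (g : R * R -> R) : {within S, continuous g} ->
    (forall z, osquare b z -> `|g z| <= `|grad_norm f z|) ->
    forall z, S z -> `|g z| <= L.
  move=> /within_continuous_on_csquare cg gle z Sz.
  rewrite leNgt; apply/negP => Lg.
  have cg' : `|g z'| @[z' --> within S (nbhs z)] --> `|g z|.
    by apply: cvg_norm; exact: cg.
  have [z' [oz h1]] := ae_csquare_within b0 (A := [set z | L < `|g z|]) fL Sz
    (cvgr_gt _ cg' _ Lg).
  by rewrite /= ltNge (le_trans (gle _ oz) h1).
move=> z Sz; split; apply: key => // w ow; have [e1 e2] := gf w ow;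
  rewrite /grad_norm e1 e2 [leRHS]ger0_norm ?sqrtr_ge0// -sqrtr_sqr;
  by rewrite ler_wsqrtr// (lerDl, lerDr) sqr_ge0.
Qed.

Lemma is_derive_line1 (f : R * R -> R) (x y : R) : differentiable f (x, y) ->
  is_derive x 1 (fun t => f (t, y)) ('D_(1, 0) f (x, y)).
Proof.
move=> df; have dv : derivable f (x, y) (1, 0) by exact: diff_derivable.
have e : (fun h : R => h^-1 *: (f (h *: 1 + x, y) - f (x, y))) =
         (fun h : R => h^-1 *: (f (h *: (1, 0) + (x, y)) - f (x, y))).
  apply/funext => h; congr (_ *: (f _ - _)).
  rewrite (_ : h *: (1, 0) + (x, y) = (h *: 1 + x, h *: 0 + y) :> R * R)//.
  by rewrite scaler0 add0r.
apply: DeriveDef; first by rewrite /derivable e.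
by rewrite /derive e.
Qed.

Lemma is_derive_line2 (f : R * R -> R) (x y : R) : differentiable f (x, y) ->
  is_derive y 1 (fun t => f (x, t)) ('D_(0, 1) f (x, y)).
Proof.
move=> df; have dv : derivable f (x, y) (0, 1) by exact: diff_derivable.
have e : (fun h : R => h^-1 *: (f (x, h *: 1 + y) - f (x, y))) =
         (fun h : R => h^-1 *: (f (h *: (0, 1) + (x, y)) - f (x, y))).
  apply/funext => h; congr (_ *: (f _ - _)).
  rewrite (_ : h *: (0, 1) + (x, y) = (h *: 0 + x, h *: 1 + y) :> R * R)//.
  by rewrite scaler0 add0r.
apply: DeriveDef; first by rewrite /derivable e.
by rewrite /derive e.
Qed.

Lemma bounded_derivative_lipschitz (h dh : R -> R) (L x x' : R) :
  0 < x < b -> 0 < x' < b ->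
  (forall t, 0 < t < b -> is_derive t 1 h (dh t)) ->
  (forall t, 0 < t < b -> `|dh t| <= L) ->
  `|h x - h x'| <= L * `|x - x'|.
Proof.
wlog xx' : x x' / x <= x'.
  move=> W hx hx' d1 d2; have [?|/ltW ?] := leP x x'; first exact: W.
  by rewrite distrC (distrC x); exact: W.
move=> /andP[hx1 hx2] /andP[hx1' hx2'] d1 d2.
have [t| |c] := @MVT_segment R h dh x x' xx'.
- by rewrite in_itv/= => /andP[? ?]; apply: d1; lra.
- apply: derivable_within_continuous => t; rewrite in_itv/= => /andP[? ?].
  by apply: ex_derive; apply: d1; lra.
rewrite in_itv/= => /andP[? ?] e; rewrite distrC e normrM (distrC x).
by rewrite ler_wpM2r// d2//; lra.
Qed.

(** Mean value theorem along the two edges of the coordinate path joining two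
    points of the square, extended to the boundary by continuity. *)
Lemma C1_csquare_lipschitz (f : R * R -> R) (L : R) : C1_csquare b f ->
  (Linfty_norm b (grad_norm f) <= L%:E)%E ->
  forall z z', S z -> S z' ->
  `|f z - f z'| <= L * (`|z.1 - z'.1| + `|z.2 - z'.2|).
Proof.
move=> [/within_continuous_on_csquare cf [g1 [g2 [c1 c2 dg]]]] fL.
have bg := partial_derivative_bound c1 c2 (fun z oz =>
  let: And3 _ d1 d2 := dg z oz in conj d1 d2) fL.
have oo z z' : osquare b z -> osquare b z' ->
    `|f z - f z'| <= L * (`|z.1 - z'.1| + `|z.2 - z'.2|).
  case: z z' => x y [x' y'] [/=]; rewrite !in_itv/= => hx hy [/=].
  rewrite !in_itv/= => hx' hy'.
  rewrite -(subrKA (f (x', y))) (le_trans (ler_normD _ _))// mulrDr lerD//.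
    apply: (@bounded_derivative_lipschitz (fun t => f (t, y)) (fun t => g1 (t, y))) => // t ht.
      have [dt <- _] : [/\ differentiable f (t, y),
        'D_(1, 0) f (t, y) = g1 (t, y) & 'D_(0, 1) f (t, y) = g2 (t, y)].
        by apply: dg; split; rewrite /= in_itv.
      exact: is_derive_line1.
    by apply: (bg (t, y) _).1; apply: osquare_csquare; split; rewrite /= in_itv.
  apply: (@bounded_derivative_lipschitz (fun t => f (x', t)) (fun t => g2 (x', t))) => // t ht.
    have [dt _ <-] : [/\ differentiable f (x', t),
      'D_(1, 0) f (x', t) = g1 (x', t) & 'D_(0, 1) f (x', t) = g2 (x', t)].
      by apply: dg; split; rewrite /= in_itv.
    exact: is_derive_line2.
  by apply: (bg (x', t) _).2; apply: osquare_csquare; split; rewrite /= in_itv.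
have cdist w : continuous_on_csquare b
    (fun z => `|f z - f w| - L * (`|z.1 - w.1| + `|z.2 - w.2|)).
  move=> z Sz; apply: cvgB.
    by apply: cvg_norm; apply: cvgB; [exact: cf|exact: cvg_cst].
  apply: cvgMr; apply: cvgD; apply: cvg_norm; apply: cvgB; try exact: cvg_cst;
    apply: cvg_within_filter; [exact: cvg_fst|exact: cvg_snd].
have so z w : S z -> osquare b w ->
    `|f z - f w| <= L * (`|z.1 - w.1| + `|z.2 - w.2|).
  move=> Sz ow; rewrite -subr_le0; apply: (osquare_dense_le (cdist w)) Sz.
  by move=> z' oz'; rewrite subr_le0; exact: oo.
move=> z z' Sz Sz'; rewrite distrC (distrC z.1) (distrC z.2) -subr_le0.
apply: (osquare_dense_le (cdist z)) Sz' => w ow.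
by rewrite subr_le0 distrC (distrC w.1) (distrC w.2); exact: so.
Qed.

End lipschitz.

(** * The covariance of a Gaussian field with continuous paths *)

Section second_moments.
Context d (T : measurableType d) (R : realType) (P : probability T R).
Implicit Types X Y : T -> R.

Definition square_integrable X :=
  measurable_fun setT X /\ P.-integrable setT (fun w => (X w ^+ 2)%:E).

Lemma square_integrable_mul X Y : square_integrable X -> square_integrable Y ->
  P.-integrable setT (EFin \o (fun w => X w * Y w)).
Proof.
move=> [mX iX] [mY iY]; have := integrableD measurableT iX iY.
apply: le_integrable => //.
  by apply/measurable_EFinP; exact: measurable_funM.
move=> w _ /=; rewrite lee_fin [leRHS]ger0_norm ?addr_ge0 ?sqr_ge0//.
rewrite ler_norml; have := sqr_ge0 (X w + Y w); have := sqr_ge0 (X w - Y w).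
by have := sqr_ge0 (X w); have := sqr_ge0 (Y w); nra.
Qed.

Lemma integrable_scale X c : P.-integrable setT (EFin \o X) ->
  P.-integrable setT (EFin \o (fun w => c * X w)).
Proof.
move=> iX; rewrite (_ : _ \o _ = (fun w => c%:E * (X w)%:E)%E).
  exact: integrableZl.
by apply/funext => w /=; rewrite EFinM.
Qed.

Lemma integrable_add X Y : P.-integrable setT (EFin \o X) ->
  P.-integrable setT (EFin \o Y) ->
  P.-integrable setT (EFin \o (fun w => X w + Y w)).
Proof.
move=> iX iY; rewrite (_ : _ \o _ = ((EFin \o X) \+ (EFin \o Y))%E)//.
exact: integrableD.
Qed.

Lemma Rintegral_sqr_affine X Y t : square_integrable X -> square_integrable Y ->
  P.-integrable setT (EFin \o (fun w => (t * X w + Y w) ^+ 2)) /\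
  \int[P]_w ((t * X w + Y w) ^+ 2) =
  t ^+ 2 * \int[P]_w (X w ^+ 2) + (2 * t) * \int[P]_w (X w * Y w) +
  \int[P]_w (Y w ^+ 2).
Proof.
move=> sX sY; have iXY := square_integrable_mul sX sY.
have e : (fun w => (t * X w + Y w) ^+ 2) =
    (fun w => (t ^+ 2 * X w ^+ 2 + (2 * t) * (X w * Y w)) + Y w ^+ 2).
  by apply/funext => w; ring.
have i1 := integrable_scale (t ^+ 2) sX.2.
have i2 := integrable_scale (2 * t) iXY.
have i12 : P.-integrable setT
    (EFin \o (fun w => t ^+ 2 * X w ^+ 2 + (2 * t) * (X w * Y w))).
  exact: integrable_add i1 i2.
rewrite e; split; first exact: integrable_add i12 sY.2.
rewrite RintegralD//; last exact: sY.2.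
by rewrite RintegralD// !RintegralZl//; exact: sX.2.
Qed.

(** The polynomial t |-> E (t X + Y)^2 is nonnegative; its value at the
    minimiser gives the inequality. *)
Lemma Rintegral_cauchy_schwarz X Y : square_integrable X -> square_integrable Y ->
  (\int[P]_w (X w * Y w)) ^+ 2 <= \int[P]_w (X w ^+ 2) * \int[P]_w (Y w ^+ 2).
Proof.
move=> sX sY; have h t : 0 <= t ^+ 2 * \int[P]_w (X w ^+ 2) +
    (2 * t) * \int[P]_w (X w * Y w) + \int[P]_w (Y w ^+ 2).
  by rewrite -(Rintegral_sqr_affine t sX sY).2 Rintegral_ge0// => w _; exact: sqr_ge0.
have a_ge0 : 0 <= \int[P]_w (X w ^+ 2).
  by rewrite Rintegral_ge0// => w _; exact: sqr_ge0.
move: h a_ge0; set a := \int[P]_w (X w ^+ 2); set c := \int[P]_w (X w * Y w).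
set e := \int[P]_w (Y w ^+ 2) => h; rewrite le_eqVlt => /predU1P[a0|a_gt0].
  have [->|c0] := eqVneq c 0; first by rewrite -a0 expr0n/= mul0r.
  (* now the polynomial is affine with slope 2 c, and takes the value -1 here *)
  have := h (- (e + 1) / (2 * c)); rewrite -a0 mulr0 add0r.
  rewrite (_ : 2 * (- (e + 1) / (2 * c)) * c + e = -1); last by field; rewrite c0.
  by rewrite ler0N1.
have := h (- c / a).
rewrite (_ : (- c / a) ^+ 2 * a + 2 * (- c / a) * c + e = (a * e - c ^+ 2) / a).
  by rewrite pmulr_lge0 ?invr_gt0// subr_ge0.
by field; rewrite gt_eqF.
Qed.

End second_moments.

Section gaussian_field_covariance.
Context d (T : measurableType d) (R : realType) (P : probability T R).
Variables (b : R) (W : R * R -> {RV P >-> R}).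
Local Notation S := (csquare b).
Hypothesis gaussW : gaussian_field S W.
Hypothesis centW : zero_mean S W.

Local Notation q z z' := (\int[P]_w (W z w * W z' w)).
Definition increment_variance z z' := \int[P]_w ((W z w - W z' w) ^+ 2).
Local Notation v := increment_variance.

Lemma field_gaussian_rv z : S z -> gaussian_rv P (W z).
Proof.
move=> Sz; have := gaussW (n := 1) (z := fun=> z) (fun=> 1) (fun=> Sz).
by rewrite (_ : (fun _ => _) = W z)//; apply/funext => w; rewrite big_ord1 mul1r.
Qed.

Lemma field_increment_gaussian_rv z z' : S z -> S z' ->
  gaussian_rv P (fun w => W z w - W z' w).
Proof.
move=> Sz Sz'; have := gaussW (n := 2)
  (z := fun i => if i == ord0 then z else z')
  (fun i => if i == ord0 then 1 else -1).
rewrite (_ : (fun _ => \sum_(i < 2) _) = (fun w => W z w - W z' w)).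
  by apply => i; case: ifP.
by apply/funext => w; rewrite 2!big_ord_recl big_ord0/= mul1r mulN1r addr0.
Qed.

Lemma field_integrable z : S z -> P.-integrable setT (EFin \o W z).
Proof.
move=> Sz; have [m [s lawX]] := field_gaussian_rv Sz.
exact: gaussian_law_integrable lawX.
Qed.

Lemma field_square_integrable z : S z -> square_integrable P (W z).
Proof.
move=> Sz; split => //.
by have [] := centered_gaussian_rv (measurable_funP (W z)) (field_gaussian_rv Sz) (centW Sz).
Qed.

Lemma measurable_increment z z' : measurable_fun setT (fun w => W z w - W z' w).
Proof. exact: measurable_funB. Qed.

Lemma increment_mean z z' : S z -> S z' ->
  ('E_P[fun w => (W z w - W z' w)%R] = 0)%E.
Proof.
move=> Sz Sz'; rewrite unlock; under eq_integral do rewrite EFinB.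
have := centW Sz; have := centW Sz'; rewrite unlock => e1 e2.
rewrite integralB//; [|exact: field_integrable..].
by rewrite e1 e2 sube0.
Qed.

Definition field_increment_facts z z' (Sz : S z) (Sz' : S z') :=
  centered_gaussian_rv (measurable_increment z z')
    (field_increment_gaussian_rv Sz Sz') (increment_mean Sz Sz').

Lemma increment_square_integrable z z' : S z -> S z' ->
  square_integrable P (fun w => W z w - W z' w).
Proof.
move=> Sz Sz'; split; first exact: measurable_increment.
by have [] := field_increment_facts Sz Sz'.
Qed.

Lemma cov_funE z z' : S z -> S z' -> cov_fun W z z' = q z z'.
Proof.
move=> Sz Sz'; rewrite /cov_fun unlock !centW//= unlock /Rintegral.
congr (fine _); apply: eq_integral => w _.
rewrite (_ : ((_ * _)%R w) = (W z w - 0) * (W z' w - 0))//.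
by rewrite !subr0.
Qed.

Lemma increment_varianceE z z' : S z -> S z' ->
  v z z' = q z z - 2 * q z z' + q z' z'.
Proof.
move=> Sz Sz'.
have := (Rintegral_sqr_affine (-1) (field_square_integrable Sz')
  (field_square_integrable Sz)).2.
rewrite /v => h; transitivity (\int[P]_w ((-1 * W z' w + W z w) ^+ 2)).
  by apply: eq_Rintegral => w _; congr (_ ^+ 2); ring.
rewrite h.
have -> : \int[P]_w (W z' w * W z w) = q z z'.
  by apply: eq_Rintegral => w _; rewrite mulrC.
by rewrite [\int[P]_w (W z' w ^+ 2)]/(q z' z') [\int[P]_w (W z w ^+ 2)]/(q z z); ring.
Qed.

Lemma increment_variance_ge0 z z' : 0 <= v z z'.
Proof. by rewrite Rintegral_ge0// => w _; exact: sqr_ge0. Qed.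

(** The double sum is the second moment of a linear combination of values of
    the field. *)
Lemma covariance_psd (I : Type) (s : seq I) (a : I -> R) (p : I -> R * R) :
  (forall i, S (p i)) ->
  0 <= \sum_(i <- s) \sum_(j <- s) a i * a j * q (p i) (p j).
Proof.
move=> Sp.
have iW i j : P.-integrable setT
    (EFin \o (fun w => a i * a j * (W (p i) w * W (p j) w))).
  by apply: integrable_scale; apply: square_integrable_mul; exact: field_square_integrable.
have -> : \sum_(i <- s) \sum_(j <- s) a i * a j * q (p i) (p j) =
    \int[P]_w ((\sum_(i <- s) a i * W (p i) w) ^+ 2).
  transitivity (\int[P]_w (\sum_(i <- s) \sum_(j <- s)
      a i * a j * (W (p i) w * W (p j) w))); last first.
    apply: eq_Rintegral => w _; rewrite expr2 big_distrlr/=.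
    by apply: eq_bigr => i _; apply: eq_bigr => j _; rewrite mulrACA.
  rewrite Rintegral_sum//; last by move=> i; apply: integrable_sum_fin.
  apply: eq_bigr => i _; rewrite Rintegral_sum//.
  apply: eq_bigr => j _; rewrite RintegralZl//.
  by apply: square_integrable_mul; exact: field_square_integrable.
by rewrite Rintegral_ge0// => w _; exact: sqr_ge0.
Qed.

(** Cauchy-Schwarz for W z - W z' and W y. *)
Lemma covariance_increment z z' y : S z -> S z' -> S y ->
  `|q z y - q z' y| <= Num.sqrt (v z z') * Num.sqrt (q y y).
Proof.
move=> Sz Sz' Sy; rewrite -sqrtrM ?increment_variance_ge0//.
have -> : q z y - q z' y = \int[P]_w ((W z w - W z' w) * W y w).
  rewrite -RintegralB//; try by apply: square_integrable_mul; exact: field_square_integrable.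
  by apply: eq_Rintegral => w _; rewrite mulrBl.
rewrite -sqrtr_sqr ler_wsqrtr//.
exact: Rintegral_cauchy_schwarz (increment_square_integrable Sz Sz') (field_square_integrable Sy).
Qed.

End gaussian_field_covariance.

Section covariance_continuity.
Context d (T : measurableType d) (R : realType) (P : probability T R).
Variables (b : R) (W : R * R -> {RV P >-> R}).
Hypothesis b0 : 0 < b.
Local Notation S := (csquare b).
Hypothesis gaussW : gaussian_field S W.
Hypothesis centW : zero_mean S W.
Hypothesis contW : ae_continuous_paths S W.
Local Notation q z z' := (\int[P]_w (W z w * W z' w)).
Local Notation v := (increment_variance W).

Lemma ae_cvg_path (u : nat -> R * R) z : S z ->
  u k @[k --> \oo] --> within S (nbhs z) ->
  {ae P, forall w, W (u k) w @[k --> \oo] --> W z w}.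
Proof.
move=> Sz uz; apply: filterS contW => w /subspace_continuousP/(_ _ Sz) cw.
exact: cvg_comp uz cw.
Qed.

(** Along a sequence of points tending to z the increments tend to 0 almost
    surely, hence in probability; if their variances stayed above some epsilon,
    each increment would exceed a fixed threshold with probability at least
    1 / 2. *)
Lemma increment_variance_seq (u : nat -> R * R) z eps : S z ->
  (forall k, S (u k)) -> u k @[k --> \oo] --> within S (nbhs z) ->
  0 < eps -> ~ (forall k, eps <= v (u k) z).
Proof.
move=> Sz Su uz e0 hv; pose c := Num.sqrt eps / 8.
have c0 : 0 < c by rewrite divr_gt0// sqrtr_gt0.
pose A k := [set w | `|W (u k) w - W z w| <= c].
have mA k : measurable (A k).
  by apply: measurable_norm_le; exact: measurable_increment.
have PA k : (P (A k) <= (2^-1)%:E)%E.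
  have vk : 0 < v (u k) z by exact: lt_le_trans (hv k).
  have [_ /(_ vk) h _] := field_increment_facts gaussW centW (Su k) Sz.
  apply: le_trans h; apply: le_measure; rewrite ?inE//.
    by apply: measurable_norm_le; exact: measurable_increment.
  move=> w /= /le_trans; apply; rewrite ler_pM2r ?invr_gt0//.
  by rewrite ler_wsqrtr//; exact: hv.
have [|||||_ _ h] := @dominated_convergence _ T R P setT measurableT
  (fun k w => (\1_(A k) w)%:E) (cst 1%E) (cst 1%E).
- by move=> k; apply/measurable_EFinP; exact: measurable_indic.
- by [].
- apply: filterS (ae_cvg_path Sz uz) => w cw _; apply: cvg_near_cst.
  have : \forall k \near \oo, `|W z w - W (u k) w| < c by move/cvgrPdist_lt : cw; exact.
  apply: filterS => k h; rewrite indicE mem_set// /A/= distrC; exact: ltW.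
- exact: finite_measure_integrable_cst.
- by apply: aeW => w k _; rewrite lee_fin indicE; case: (_ \in _); rewrite ?normr1 ?normr0.
have : (1%E <= (2^-1 : R)%:E :> \bar R)%E.
  move: h; rewrite integral_cst//= probability_setT mul1e => h.
  rewrite -(cvg_lim _ h)//; apply: lime_le; first by apply/cvgP: h.
  apply: nearW => k; rewrite integral_indic// setIT; exact: PA.
by rewrite lee_fin invf_ge1// lern1.
Qed.

Lemma within_seq (z : R * R) (A : set (R * R)) : ~ within S (nbhs z) A ->
  exists u : nat -> R * R,
    [/\ forall k, S (u k), u k @[k --> \oo] --> within S (nbhs z) &
        forall k, ~ A (u k)].
Proof.
move=> nA; have h k : exists u : R * R, [/\ ball z (k.+1%:R^-1 : R) u, S u & ~ A u].
  apply: contrapT => h; apply: nA; apply/nbhs_ballP; exists (k.+1%:R^-1) => //=.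
  move=> u bu Su; apply: contrapT => nAu; apply: h; by exists u.
pose u k := sval (cid (h k)); exists u.
have uP k : [/\ ball z (k.+1%:R^-1 : R) (u k), S (u k) & ~ A (u k)].
  exact: svalP (cid (h k)).
split; [by move=> k; have [] := uP k| |by move=> k; have [] := uP k].
move=> B /nbhs_ballP[e /= e0 hB].
suff : \forall k \near \oo, B (u k) by [].
near=> k; have [bk Sk _] := uP k; apply: (hB (u k)) Sk.
apply: le_ball bk; near: k; apply: filterS (near_infty_natSinv_lt (PosNum e0)) => k.
exact: ltW.
Unshelve. all: by end_near. Qed.

Lemma increment_variance_cvg0 z : S z -> v z' z @[z' --> within S (nbhs z)] --> 0.
Proof.
move=> Sz; apply/cvgrPdist_lt => e e0; apply: contrapT => h.
have [u [Su uz nu]] := within_seq h.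
apply: (increment_variance_seq Sz Su uz e0) => k.
have := nu k; rewrite sub0r normrN ger0_norm ?increment_variance_ge0// => /negP.
by rewrite -leNgt.
Qed.

Lemma sqrt_increment_variance_cvg0 z : S z ->
  Num.sqrt (v z' z) @[z' --> within S (nbhs z)] --> 0.
Proof.
move=> Sz; rewrite -[X in _ --> X]sqrtr0.
apply: (cvg_comp (fun z' => v z' z) Num.sqrt).
  exact: increment_variance_cvg0.
exact: sqrt_continuous.
Qed.

Lemma near_within_S z : S z -> \forall z' \near within S (nbhs z), S z'.
Proof. by move=> _; apply: withinT; exact: nbhs_filter. Qed.

Lemma covariance_continuous y : S y -> continuous_on_csquare b (fun z => q z y).
Proof.
move=> Sy z Sz; apply/cvgrPdist_le => e e0.
have h : Num.sqrt (v z' z) * Num.sqrt (q y y) @[z' --> within S (nbhs z)] --> 0.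
  rewrite -[X in _ --> X](mul0r (Num.sqrt (q y y))).
  by apply: cvgMl; exact: sqrt_increment_variance_cvg0.
move/cvgrPdist_le : h => /(_ _ e0) h.
near=> z'; rewrite distrC.
have Sz' : S z' by near: z'; exact: near_within_S.
apply: (le_trans (covariance_increment gaussW centW Sz' Sz Sy)).
have : `|0 - Num.sqrt (v z' z) * Num.sqrt (q y y)| <= e by near: z'.
by rewrite sub0r normrN; apply: le_trans; exact: ler_norm.
Unshelve. all: by end_near. Qed.

Lemma covariance_symm z z' : q z z' = q z' z.
Proof. by apply: eq_Rintegral => w _; rewrite mulrC. Qed.

Lemma variance_continuous : continuous_on_csquare b (fun z => q z z).
Proof.
move=> z Sz.
(* expand the square in v z' z to express q z' z' by convergent terms *)
have c : 2 * q z' z - q z z + v z' z @[z' --> within S (nbhs z)] --> q z z.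
  rewrite -[X in _ --> X](_ : 2 * q z z - q z z + 0 = q z z); last by ring.
  apply: cvgD; last exact: increment_variance_cvg0.
  apply: cvgB; last exact: cvg_cst.
  by apply: cvgMr; exact: covariance_continuous.
apply: cvg_trans c; apply: near_eq_cvg.
apply: filterS (near_within_S Sz) => z' Sz'.
by rewrite (increment_varianceE gaussW centW Sz' Sz); ring.
Qed.

Lemma variance_bounded : exists M, forall z, S z -> q z z <= M.
Proof.
have cS : compact S by apply: compact_setX; exact: segment_compact.
have cq : {within S, continuous (fun z => q z z)}.
  by apply/subspace_continuousP; exact: variance_continuous.
have [M [_ hM]] := compact_bounded (continuous_compact cq cS).
exists (M + 1) => z Sz; apply: (le_trans (ler_norm _)).
by apply: (hM (M + 1)); [rewrite ltrDl|exists z].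
Qed.

Lemma covariance_bounded : exists M, forall z z', S z -> S z' -> `|q z z'| <= M.
Proof.
have [M hM] := variance_bounded; exists `|M| => z z' Sz Sz'.
rewrite -(ler_pXn2r (n := 2)) ?nnegrE// real_normK ?num_real//.
have := Rintegral_cauchy_schwarz (field_square_integrable gaussW centW Sz)
  (field_square_integrable gaussW centW Sz').
move=> /le_trans; apply.
have q0 y : 0 <= \int[P]_w (W y w ^+ 2).
  by rewrite Rintegral_ge0// => w _; exact: sqr_ge0.
have qM y : S y -> \int[P]_w (W y w ^+ 2) <= `|M|.
  by move=> Sy; apply: le_trans (ler_norm _); exact: hM.
by rewrite expr2 ler_pM// qM.
Qed.

Lemma covariance_grid_cvg z z' : S z -> S z' ->
  q (grid_round b m z) (grid_round b m z') @[m --> \oo] --> q z z'.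
Proof.
move=> Sz Sz'; have [M hM] := variance_bounded.
have gz := cvg_grid_round b0 Sz.
have h1 : Num.sqrt (v (grid_round b m z') z') * Num.sqrt M @[m --> \oo] --> 0.
  rewrite -[X in _ --> X](mul0r (Num.sqrt M)); apply: cvgMl.
  by apply: (cvg_comp _ (fun x => Num.sqrt (v x z')) (cvg_grid_round b0 Sz'));
    exact: sqrt_increment_variance_cvg0.
have h2 : q (grid_round b m z) z' - q z z' @[m --> \oo] --> 0.
  rewrite -(subrr (q z z')); apply: cvgB; last exact: cvg_cst.
  exact: (cvg_continuous_on_csquare b0 (covariance_continuous Sz') Sz).
apply/cvgrPdist_le => e e0.
have e20 : 0 < e / 2 by rewrite divr_gt0.
move/cvgrPdist_le : h1 => /(_ _ e20) h1; move/cvgrPdist_le : h2 => /(_ _ e20) h2.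
near=> m; have Sm y : S y -> S (grid_round b m y) by exact: grid_round_csquare.
rewrite distrC.
rewrite -(subrKA (q (grid_round b m z) z')) (le_trans (ler_normD _ _))//.
rewrite [leRHS](splitr e) lerD//; last first.
  by rewrite -normrN -sub0r; near: m.
rewrite covariance_symm (covariance_symm _ z').
apply: (le_trans (covariance_increment gaussW centW (Sm _ Sz') Sz' (Sm _ Sz))).
apply: (@le_trans _ _ `|0 - Num.sqrt (v (grid_round b m z') z') * Num.sqrt M|).
  rewrite sub0r normrN ger0_norm ?mulr_ge0 ?sqrtr_ge0// ler_wpM2l ?sqrtr_ge0//.
  by rewrite ler_wsqrtr// hM//; exact: Sm.
by near: m.
Unshelve. all: by end_near. Qed.

End covariance_continuity.

(** * Mercer expansion of the covariance *)

Section mercer.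
Context d (T : measurableType d) (R : realType) (P : probability T R).
Variables (b : R) (W : R * R -> {RV P >-> R}).
Hypothesis b0 : 0 < b.
Local Notation S := (csquare b).
Local Notation mu := (@lebesgue_measure R \x @lebesgue_measure R)%E.
Hypothesis gaussW : gaussian_field S W.
Hypothesis centW : zero_mean S W.
Hypothesis contW : ae_continuous_paths S W.
Local Notation q z z' := (\int[P]_w (W z w * W z' w)).

Lemma Rintegral_csquare_le (g : R * R -> R) K : measurable_fun S g ->
  (forall z, S z -> `|g z| <= K) -> `|\int[mu]_(z in S) g z| <= K * b ^+ 2.
Proof.
move=> mg gK; have ig := bounded_integrable_csquare b0 mg gK.
apply: (le_trans (le_normr_Rintegral (measurable_csquare_prod b) ig)).
have -> : K * b ^+ 2 = \int[mu]_(z in S) K.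
  rewrite Rintegral_cst; last exact: measurable_csquare_prod.
  by congr (_ * _); exact: (esym (congr1 fine (mu_csquare b0))).
apply: le_Rintegral; first exact: measurable_csquare_prod.
- apply: (bounded_integrable_csquare b0 (M := K)).
    exact: measurableT_comp.
  by move=> z Sz; rewrite normr_id gK.
- by apply: (bounded_integrable_csquare b0 (M := `|K|)).
- exact: gK.
Qed.

Let cq := covariance_continuous gaussW centW contW.

Lemma covariance_continuous_r z : S z -> continuous_on_csquare b (fun z' => q z z').
Proof.
move=> Sz y Sy; rewrite covariance_symm.
by under eq_cvg do rewrite covariance_symm; exact: cq.
Qed.

Lemma measurable_covariance z : S z -> measurable_fun S (fun z' => q z z').
Proof.
by move=> Sz; apply: measurable_continuous_on_csquare => //; exact: covariance_continuous_r.
Qed.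

Lemma cov_opE f z : S z -> cov_op b W f z = \int[mu]_(z' in S) (q z z' * f z').
Proof.
move=> Sz; rewrite /cov_op; apply: eq_Rintegral => z' /set_mem Sz'.
by rewrite (cov_funE centW).
Qed.

Section bounded_function.
Variables (f : R * R -> R) (C : R).
Hypotheses (cf : continuous_on_csquare b f) (fC : forall z, S z -> `|f z| <= C).

Let mf := measurable_continuous_on_csquare b0 cf.

Lemma cov_op_continuous : continuous_on_csquare b (cov_op b W f).
Proof.
have [M hM] := variance_bounded gaussW centW contW.
move=> z Sz; apply/cvgrPdist_le => e e0.
pose K := Num.sqrt M * C * b ^+ 2.
have h : Num.sqrt (increment_variance W z' z) * K @[z' --> within S (nbhs z)] --> 0.
  rewrite -[X in _ --> X](mul0r K).
  by apply: cvgMl; exact: (sqrt_increment_variance_cvg0 gaussW centW contW).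
move/cvgrPdist_le : h => /(_ _ e0) h.
near=> z'; rewrite distrC.
have Sz' : S z' by near: z'; exact: near_within_S Sz.
have C0 : 0 <= C by exact: le_trans (fC Sz).
have iqf y : S y -> mu.-integrable S (EFin \o (fun z' => q y z' * f z')).
  have [N hN] := covariance_bounded gaussW centW contW.
  move=> Sy; apply: (bounded_integrable_csquare b0 (M := N * C)).
    by apply: measurable_funM => //; exact: measurable_covariance.
  by move=> x Sx; rewrite normrM ler_pM// ?hN ?fC.
rewrite !cov_opE// -RintegralB; [|exact: measurable_csquare_prod|exact: iqf..].
apply: (@le_trans _ _ (Num.sqrt (increment_variance W z' z) * Num.sqrt M * C * b ^+ 2)).
  apply: Rintegral_csquare_le.
    by apply: measurable_funB; apply: measurable_funM => //; exact: measurable_covariance.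
  move=> x Sx; rewrite -mulrBl normrM ler_pM ?fC//.
  apply: (le_trans (covariance_increment gaussW centW Sz' Sz Sx)).
  by rewrite ler_wpM2l ?sqrtr_ge0// ler_wsqrtr// hM.
have : `|0 - Num.sqrt (increment_variance W z' z) * K| <= e by near: z'.
by rewrite sub0r normrN /K !mulrA; apply: le_trans; exact: ler_norm.
Unshelve. all: by end_near. Qed.

(** Positivity of the covariance operator: the quadratic form is the limit of
    its Riemann sums over dyadic grids, which are second moments of finite
    linear combinations of values of the field. *)
Lemma cov_op_psd : 0 <= \int[mu]_(z in S) (f z * cov_op b W f z).
Proof.
have [N hN] := covariance_bounded gaussW centW contW.
have S0 : S (0, 0) by split; rewrite /= in_itv/= lexx ltW.
have C0 : 0 <= C by exact: le_trans (fC S0).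
have N0 : 0 <= N by exact: le_trans (hN _ _ S0 S0).
pose F m (x : R * R) := f x *
  \int[mu]_(z' in S) (q x (grid_round b m z') * f (grid_round b m z')).
have FE m (x : R * R) : F m x = \sum_(i < (2 ^ m).+1) \sum_(j < (2 ^ m).+1)
   f x * (q x (grid_point b m i j) * f (grid_point b m i j)
          * fine (mu (grid_cell b m i j))).
  rewrite /F (Rintegral_grid_round b0 (fun z' => q x z' * f z')) mulr_sumr.
  by apply: eq_bigr => i _; rewrite mulr_sumr.
have Fb m z : S z -> `|F m (grid_round b m z)| <= C * (N * C * b ^+ 2).
  move=> Sz; have Sm := grid_round_csquare m b0 Sz.
  rewrite /F normrM ler_pM ?fC//; apply: Rintegral_csquare_le.
    exact: (measurable_grid_round b0 (fun z' => q (grid_round b m z) z' * f z')).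
  move=> x Sx; have Smx := grid_round_csquare m b0 Sx.
  by rewrite normrM ler_pM ?hN ?fC.
have lim : \int[mu]_(z in S) F m (grid_round b m z) @[m --> \oo]
    --> \int[mu]_(z in S) (f z * cov_op b W f z).
  apply: (bounded_cvg_csquare b0 (M := C * (N * C * b ^+ 2))).
  - by move=> m; exact: measurable_grid_round.
  - exact: Fb.
  - move=> z Sz; apply: cvgM.
      exact: cvg_continuous_on_csquare.
    rewrite cov_opE//; apply: (bounded_cvg_csquare b0 (M := N * C)).
    + move=> m; exact: (measurable_grid_round b0 (fun z' => q (grid_round b m z) z' * f z')).
    + move=> m x Sx; have := grid_round_csquare m b0 Sx.
      by have := grid_round_csquare m b0 Sz; move=> ? ?; rewrite normrM ler_pM ?hN ?fC.
    + move=> x Sx; apply: cvgM; last exact: cvg_continuous_on_csquare.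
      exact: (covariance_grid_cvg b0 gaussW centW contW).
rewrite -(cvg_lim _ lim)//; apply: limr_ge; first by apply/cvgP: lim.
apply: nearW => m; rewrite (Rintegral_grid_round b0 (F m)).
pose a (p : 'I_(2 ^ m).+1 * 'I_(2 ^ m).+1) :=
  f (grid_point b m p.1 p.2) * fine (mu (grid_cell b m p.1 p.2)).
have /= h := covariance_psd gaussW centW
  (index_enum ('I_(2 ^ m).+1 * 'I_(2 ^ m).+1)%type) a
  (p := fun p => grid_point b m p.1 p.2).
apply: (le_trans (h _)).
  by move=> p; apply: grid_csquare => //; rewrite -ltnS.
rewrite [leRHS]pair_bigA/=; apply: ler_sum => p _.
rewrite FE pair_bigA/= mulr_suml; apply: ler_sum => p' _.
have alg (x1 x2 x3 x4 x5 : R) :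
  x1 * x2 * (x3 * x4) * x5 = x1 * (x5 * x3 * x4) * x2 by ring.
by rewrite /a alg.
Qed.

End bounded_function.
End mercer.

Section mercer_expansion.
Context d (T : measurableType d) (R : realType) (P : probability T R).
Variables (b : R) (W : R * R -> {RV P >-> R}).
Hypothesis b0 : 0 < b.
Local Notation S := (csquare b).
Local Notation mu := (@lebesgue_measure R \x @lebesgue_measure R)%E.
Hypothesis gaussW : gaussian_field S W.
Hypothesis centW : zero_mean S W.
Hypothesis contW : ae_continuous_paths S W.
Local Notation q z z' := (\int[P]_w (W z w * W z' w)).
Variables (lam : nat -> R) (e : nat -> R * R -> R) (C : R).
Hypothesis eigen : eigenpairs_of b W lam e.
Hypothesis ce : forall i, continuous_on_csquare b (e i).
Hypothesis eC : forall i z, S z -> `|e i z| <= C.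

(** The eigenvalue equation holds almost everywhere between continuous
    functions. *)
Lemma eigen_everywhere i z : S z ->
  \int[mu]_(z' in S) (q z z' * e i z') = lam i * e i z.
Proof.
move=> Sz; rewrite -(cov_opE (b := b) centW)//.
apply: (ae_eq_csquare b0 (f := cov_op b W (e i)) (g := fun z => lam i * e i z)) Sz.
- by apply: (cov_op_continuous b0 gaussW centW contW (C := C)) => [|z']; [exact: ce|exact: eC].
- by move=> z' Sz'; apply: cvgMr; exact: ce.
- exact: eigen.2.
Qed.

(** An eigenvalue is the value of a nonnegative quadratic form at a unit
    vector. *)
Lemma eigenvalue_ge0 i : 0 <= lam i.
Proof.
have := cov_op_psd b0 gaussW centW contW (@ce i) (@eC i).
have -> : \int[mu]_(z in S) (e i z * cov_op b W (e i) z) =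
    \int[mu]_(z in S) (lam i * (e i z * e i z)).
  apply: eq_Rintegral => z /set_mem Sz.
  by rewrite cov_opE// eigen_everywhere// mulrCA.
rewrite RintegralZl; last 2 first.
- exact: measurable_csquare_prod.
- apply: (bounded_integrable_csquare b0 (M := C * C)).
    by apply: measurable_funM; exact: measurable_continuous_on_csquare.
  by move=> z Sz; rewrite normrM ler_pM// eC.
have [_ + _] := eigen.1; move=> /(_ i i); rewrite /L2_inner eqxx => ->.
by rewrite mulr1.
Qed.

Hypothesis lam_summable : exists L, forall N, \sum_(i < N) lam i <= L.

Lemma eigenvalue_tail eps : 0 < eps ->
  exists N0, forall N M, (N0 <= N)%N -> (N <= M)%N -> \sum_(N <= i < M) lam i <= eps.
Proof.
move=> e0; have [L hL] := lam_summable.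
have nd : nondecreasing_seq (fun N => \sum_(0 <= i < N) lam i).
  apply/nondecreasing_seqP => n; rewrite big_nat_recr//= lerDl.
  exact: eigenvalue_ge0.
have cv : cvgn (fun N => \sum_(0 <= i < N) lam i).
  apply: nondecreasing_is_cvgn => //; exists L => _ [N _ <-].
  by rewrite big_mkord.
set l := limn (fun N => \sum_(0 <= i < N) lam i) in cv *.
have ul N : \sum_(0 <= i < N) lam i <= l by exact: nondecreasing_cvgn_le.
have [N0 _ hN0] : \forall N \near \oo, l - \sum_(0 <= i < N) lam i <= eps.
  have /cvgrPdist_le/(_ _ e0) : (fun N => \sum_(0 <= i < N) lam i) @ \oo --> l by [].
  by apply: filterS => N; apply: le_trans; exact: ler_norm.
exists N0 => N M N0N NM; apply: le_trans (hN0 N N0N).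
by rewrite lerBrDl -big_cat_nat//=; exact: ul.
Qed.

Let partial N z z' := \sum_(i < N) lam i * e i z * e i z'.
Let defect N z z' := q z z' - partial N z z'.

Lemma L2_covariance z : S z -> L2_csquare b (fun z' => q z z').
Proof.
move=> Sz; split; first exact: measurable_covariance.
have [M hM] := covariance_bounded gaussW centW contW.
have mq2 : measurable_fun S (fun z' => (q z z') ^+ 2).
  by apply: measurable_funX; exact: measurable_covariance.
have := bounded_integrable_csquare b0 (M := M ^+ 2) mq2 _.
move=> /(_ _)/integrableP[|_].
  move=> z' Sz'; rewrite normrX ler_pXn2r ?nnegrE//; first exact: hM.
  by apply: le_trans (hM _ _ Sz Sz').
apply: le_lt_trans; rewrite le_eqVlt; apply/orP; left; apply/eqP.
by apply: eq_integral => z' _; rewrite gee0_abs// lee_fin sqr_ge0.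
Qed.

(** By [eigen_everywhere], lam i * e i z is the coefficient of q z on e i. *)
Lemma defect_L2_cvg z : S z ->
  (\int[mu]_(z' in S) ((defect N z z') ^+ 2)%:E)%E @[N --> \oo] --> 0%E.
Proof.
move=> Sz; have [_ _ /(_ _ (L2_covariance Sz))] := eigen.1.
apply: cvg_trans; apply: near_eq_cvg; apply: nearW => N.
apply: eq_integral => z' _; congr ((_ ^+ 2)%:E); congr (_ - _).
apply: eq_bigr => i _; congr (_ * _).
by rewrite /L2_inner eigen_everywhere.
Qed.

Lemma continuous_on_csquare_sum (I : Type) (s : seq I) (f : I -> R * R -> R) :
  (forall i, continuous_on_csquare b (f i)) ->
  continuous_on_csquare b (fun z => \sum_(i <- s) f i z).
Proof.
move=> cf z Sz; elim: s => [|i s IH].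
  under eq_fun do rewrite big_nil; rewrite big_nil; exact: cvg_cst.
under eq_fun do rewrite big_cons; rewrite big_cons.
by apply: cvgD => //; exact: cf.
Qed.

Lemma defect_continuous N z : S z -> continuous_on_csquare b (defect N z).
Proof.
move=> Sz y Sy; apply: cvgB; first exact: (covariance_continuous_r gaussW centW contW).
apply: (@continuous_on_csquare_sum 'I_N _ (fun i z' => lam i * e i z * e i z')) => // i.
by move=> x Sx; apply: cvgMr; exact: ce.
Qed.

Lemma defect_tail eps : 0 < eps -> exists N0, forall N M z z', (N0 <= N)%N ->
  (N <= M)%N -> S z -> S z' -> `|defect N z z' - defect M z z'| <= eps.
Proof.
move=> e0; have p : 0 < C ^+ 2 + 1 by rewrite ltr_wpDl ?sqr_ge0.
have [N0 hN0] := eigenvalue_tail (divr_gt0 e0 p).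
exists N0 => N M z z' N0N NM Sz Sz'.
rewrite /defect /partial opprB addrC subrKA -!(big_mkord xpredT (fun i => lam i * e i z * e i z')).
rewrite (big_cat_nat (leq0n N) NM)/= addrAC subrr add0r.
apply: (le_trans (ler_norm_sum _ _ _)).
apply: (@le_trans _ _ (\sum_(N <= i < M) lam i * (C ^+ 2 + 1))).
  apply: ler_sum => i _; rewrite -mulrA normrM ger0_norm ?eigenvalue_ge0//.
  rewrite ler_wpM2l ?eigenvalue_ge0// normrM (@le_trans _ _ (C ^+ 2)) ?lerDl//.
  by rewrite expr2 ler_pM ?eC.
by rewrite -mulr_suml -ler_pdivlMr// hN0.
Qed.

(** Since the eigenfunctions form a basis, the partial sums converge to the
    covariance in the mean; they are uniformly Cauchy and everything in sight is
    continuous, so that they converge to it at every point. *)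
Lemma mercer z z' : S z -> S z' ->
  \sum_(i < N) lam i * e i z * e i z' @[N --> \oo] --> q z z'.
Proof.
move=> Sz Sz'; apply/cvgrPdist_le => eps e0.
have [N0 hN0] := defect_tail (divr_gt0 e0 (ltr0Sn R 1)).
(* Otherwise the defect at N exceeds eps on a neighbourhood of z', hence the
   defect at every later M exceeds eps / 2 on a set of positive measure, against
   the convergence in the mean. *)
exists N0 => //= N N0N; rewrite leNgt; apply/negP => big.
pose A := [set y | eps < `|defect N z y|].
have wA : within S (nbhs z') A.
  have c : `|defect N z y| @[y --> within S (nbhs z')] --> `|defect N z z'|.
    by apply: cvg_norm; exact: defect_continuous.
  exact: (cvgr_gt _ c _ big).
have [r r0 hr] := nbhs_box wA.
have [B [mB B0 BS nB]] := csquare_near_pos b0 Sz' r0.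
have BS' y : B y -> S y by move=> /BS; exact: osquare_csquare.
have low M : (N <= M)%N ->
    (((eps / 2) ^+ 2)%:E * mu B <= \int[mu]_(y in S) ((defect M z y) ^+ 2)%:E)%E.
  move=> NM; rewrite -integral_cst//.
  have mD : measurable_fun S (fun y => (defect M z y) ^+ 2).
    apply: measurable_funX; apply: measurable_continuous_on_csquare => //.
    exact: defect_continuous.
  apply: (@le_trans _ _ (\int[mu]_(y in B) ((defect M z y) ^+ 2)%:E)%E).
    apply: ge0_le_integral => //.
    - by move=> y _; rewrite lee_fin sqr_ge0.
    - by apply/measurable_EFinP; apply: measurable_funS mD; [exact: measurable_csquare_prod|exact: BS'].
    - move=> y By; rewrite lee_fin -(real_normK (num_real (defect M z y))).
      have Sy := BS' _ By; have [n1 n2] := nB _ By.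
      have h1 := hr y n1 n2 Sy; have h2 := hN0 N M z y N0N NM Sz Sy.
      rewrite ler_pXn2r ?nnegrE ?divr_ge0 ?(ltW e0)//.
      have h3 : eps < `|defect N z y| by exact: h1.
      have := ler_normD (defect N z y - defect M z y) (defect M z y).
      by rewrite subrK; lra.
  apply: ge0_subset_integral => //.
  - exact: measurable_csquare_prod.
  - by apply/measurable_EFinP.
  - by move=> y _; rewrite lee_fin sqr_ge0.
have pos : (0 < ((eps / 2) ^+ 2)%:E * mu B)%E.
  by rewrite mule_gt0// lte_fin exprn_gt0// divr_gt0.
have cv := defect_L2_cvg Sz.
have : (((eps / 2) ^+ 2)%:E * mu B <= 0)%E.
  rewrite -(cvg_lim _ cv)//; apply: lime_ge; first by apply/cvgP: cv.
  by exists N => //= M; exact: low.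
by rewrite leNgt pos.
Qed.

Lemma increment_variance_le_sum z z' K : S z -> S z' ->
  (forall N, \sum_(i < N) lam i * (e i z - e i z') ^+ 2 <= K) ->
  increment_variance W z z' <= K.
Proof.
move=> Sz Sz' hK; rewrite (increment_varianceE gaussW centW Sz Sz').
have eN N : \sum_(i < N) lam i * (e i z - e i z') ^+ 2 =
    \sum_(i < N) lam i * e i z * e i z - 2 * \sum_(i < N) lam i * e i z * e i z' +
    \sum_(i < N) lam i * e i z' * e i z'.
  rewrite mulr_sumr -sumrB -big_split/=; apply: eq_bigr => i _.
  by ring.
have c : \sum_(i < N) lam i * (e i z - e i z') ^+ 2 @[N --> \oo] -->
    q z z - 2 * q z z' + q z' z'.
  under eq_cvg do rewrite eN.
  by apply: cvgD; [apply: cvgB; [|apply: cvgMr]|]; exact: mercer.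
rewrite -(cvg_lim _ c)//; apply: limr_le; first by apply/cvgP: c.
exact: nearW.
Qed.

End mercer_expansion.

(** * Chaining over dyadic grids *)

Section holder.
Context {R : realType}.
Implicit Types x t h C : R.

(** Put t = n^alpha h. If t >= 1, the trivial bound on x suffices; if t < 1,
    the Lipschitz bound does, since t^2 <= t^gam for gam <= 2. The exponent
    gam is chosen such that n^(alpha gam) <= n^beta. *)
Lemma sqr_interpolation (alpha beta C h x n : R) : 0 < alpha -> 0 < beta ->
  1 <= n -> 0 <= h -> 0 <= C -> `|x| <= 2 * C -> `|x| <= C * n `^ alpha * h ->
  x ^+ 2 <= 4 * C ^+ 2 * (n `^ beta * h `^ Num.min 2 (beta / alpha)).
Proof.
move=> a0 b0 n1 h0 C0 x1 x2; set gam := Num.min _ _.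
have n0 : 0 <= n by exact: le_trans n1.
have gam0 : 0 < gam by rewrite lt_min ltr0n divr_gt0.
have gam2 : gam <= 2 by rewrite ge_min lexx.
have agb : alpha * gam <= beta.
  by rewrite mulrC -ler_pdivlMr// ge_min lexx orbT.
pose t := n `^ alpha * h.
have t0 : 0 <= t by rewrite mulr_ge0// powR_ge0.
have tgam : t `^ gam <= n `^ beta * h `^ gam.
  rewrite powRM ?powR_ge0// ler_wpM2r ?powR_ge0// -powRrM.
  exact: ler_powR.
apply: (@le_trans _ _ (4 * C ^+ 2 * t `^ gam)); last first.
  by rewrite ler_wpM2l// mulr_ge0// sqr_ge0.
rewrite -(real_normK (num_real x)).
have [t1|t1] := leP 1 t.
  apply: (@le_trans _ _ (4 * C ^+ 2 * 1)).
    rewrite mulr1 (_ : 4 * C ^+ 2 = (2 * C) ^+ 2); last by ring.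
    by rewrite ler_pXn2r// nnegrE ?mulr_ge0.
  rewrite ler_wpM2l ?mulr_ge0 ?sqr_ge0//.
  by rewrite -(powRr0 t) ler_powR// ltW.
apply: (@le_trans _ _ (C ^+ 2 * t ^+ 2)).
  rewrite -exprMn ler_pXn2r ?nnegrE ?normr_ge0 ?(mulr_ge0 C0 t0)//.
  by rewrite /t mulrA.
have : t ^+ 2 <= t `^ gam.
  move: t0; rewrite le_eqVlt => /predU1P[<-|t0].
    by rewrite expr0n/= powR_ge0.
  by rewrite -powR_mulrn ?(ltW t0)// ger_powR// t0 ltW.
move=> tt; apply: (@le_trans _ _ (C ^+ 2 * t `^ gam)).
  by rewrite ler_wpM2l// sqr_ge0.
by rewrite ler_wpM2r ?powR_ge0// ler_peMl ?sqr_ge0// ler1n.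
Qed.

Lemma sum_geometric_le (r : R) n : 0 < r -> r < 1 ->
  \sum_(k < n) r ^+ k <= (1 - r)^-1.
Proof.
move=> r0 r1; have d : 0 < 1 - r by rewrite subr_gt0.
suff -> : \sum_(k < n) r ^+ k = (1 - r ^+ n) / (1 - r).
  by rewrite ler_piMl ?invr_ge0 ?(ltW d)// gerBl exprn_ge0// ltW.
elim: n => [|n IH]; first by rewrite big_ord0 expr0 subrr mul0r.
by rewrite big_ord_recr/= IH exprS; field; rewrite gt_eqF.
Qed.

Lemma sum_arith_geometric_le (r : R) n : 0 < r -> r < 1 ->
  \sum_(k < n) k%:R * r ^+ k <= (1 - r) ^- 2.
Proof.
move=> r0 r1; have d : 0 < 1 - r by rewrite subr_gt0.
apply: (@le_trans _ _ (\sum_(k < n) k.+1%:R * r ^+ k)).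
  apply: ler_sum => k _; rewrite ler_wpM2r ?exprn_ge0 ?(ltW r0)//.
  by rewrite ler_nat.
suff -> : \sum_(k < n) k.+1%:R * r ^+ k =
    (1 - r ^+ n * (1 + n%:R * (1 - r))) / (1 - r) ^+ 2.
  rewrite ler_piMl ?invr_ge0 ?sqr_ge0// gerBl mulr_ge0 ?exprn_ge0 ?(ltW r0)//.
  by rewrite addr_ge0 ?mulr_ge0 ?(ltW d).
elim: n => [|n IH]; first by rewrite big_ord0 expr0 mul0r addr0 mulr1 subrr mul0r.
rewrite big_ord_recr/= IH (exprS r) -natr1; field.
by rewrite gt_eqF.
Qed.

End holder.

Section links.
Context d (T : measurableType d) (R : realType) (P : probability T R).
Variables (b : R) (W : R * R -> {RV P >-> R}).
Hypothesis b0 : 0 < b.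
Local Notation S := (csquare b).
Hypothesis gaussW : gaussian_field S W.
Hypothesis centW : zero_mean S W.
Hypothesis contW : ae_continuous_paths S W.
Variables (gam Kv : R).
Hypotheses (gam0 : 0 < gam) (Kv0 : 0 <= Kv).
Hypothesis holderW : forall z z', S z -> S z' -> increment_variance W z z' <=
  Kv * (`|z.1 - z'.1| + `|z.2 - z'.2|) `^ gam.

(** The terms of the telescoping sum [link_sum]; there is no grid coarser than
    that of level 0. *)
Definition link k (i j : nat) (w : T) : R :=
  if k is k'.+1 then W (grid_point b k i j) w - W (grid_point b k' i./2 j./2) w
  else W (grid_point b 0 i j) w.

Lemma measurable_link k i j : measurable_fun setT (link k i j).
Proof. by case: k => [|k]; [exact: measurable_funP|exact: measurable_funB]. Qed.

Lemma link_sum n z w : S z -> W (grid_round b n z) w =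
  \sum_(k < n.+1) link k (grid_index b k z.1) (grid_index b k z.2) w.
Proof.
move=> [/=]; rewrite !in_itv/= => /andP[z1 _] /andP[z2 _].
elim: n => [|n IH]; first by rewrite big_ord_recl big_ord0 addr0.
rewrite big_ord_recr/= -IH -!grid_index_half// addrC subrK//.
Qed.

Lemma grid_half_dist k i : `|grid b k.+1 i - grid b k i./2| <= b / 2 ^+ k.+1.
Proof.
have p : 0 < 2 ^+ k.+1 :> R by rewrite exprn_gt0.
have -> : grid b k.+1 i - grid b k i./2 = b * (odd i)%:R / 2 ^+ k.+1.
  rewrite /grid -{1}(odd_double_half i) natrD -muln2 natrM exprS; field.
  by rewrite expf_neq0.
rewrite normrM normrM (gtr0_norm b0) normfV (gtr0_norm p).
rewrite ler_pM2r ?invr_gt0//; case: (odd i); first by rewrite normr1 mulr1.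
by rewrite normr0 mulr0 ltW.
Qed.

(** The rate at which the standard deviations of the links decrease with the
    level. *)
Definition ratio : R := (2^-1) `^ (gam / 2).

Lemma ratio_gt0 : 0 < ratio.
Proof. by rewrite powR_gt0// invr_gt0. Qed.

Lemma ratio_lt1 : ratio < 1.
Proof.
rewrite -[ltRHS](congr1 (@^~ (gam / 2)) (@powR1 R)).
by rewrite gt0_ltr_powR ?nnegrE ?divr_gt0 ?invr_ge0// invf_lt1// ltr1n.
Qed.

Lemma ratioX k : (2^-1 ^+ k) `^ gam = (ratio ^+ k) ^+ 2.
Proof.
rewrite -exprM -(powR_mulrn k (a := 2^-1)) ?invr_ge0// -powRrM.
rewrite -(powR_mulrn (k * 2) (a := ratio)) ?(ltW ratio_gt0)// /ratio -powRrM.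
by congr (_ `^ _); rewrite natrM; field.
Qed.

Lemma increment_link_variance k i j : (i <= 2 ^ k.+1)%N -> (j <= 2 ^ k.+1)%N ->
  increment_variance W (grid_point b k.+1 i j) (grid_point b k i./2 j./2) <=
  Kv * (2 * b) `^ gam * (ratio ^+ k.+1) ^+ 2.
Proof.
move=> ik jk.
have half m : (m <= 2 ^ k.+1)%N -> (m./2 <= 2 ^ k)%N.
  by move=> mk; rewrite -leq_double -[leqRHS]mul2n -expnS (leq_trans _ mk)//
    -[leqRHS]odd_double_half leq_addl.
apply: (le_trans (holderW (grid_csquare b0 ik jk)
  (grid_csquare b0 (half _ ik) (half _ jk)))).
rewrite -mulrA ler_wpM2l// -ratioX -powRM ?mulr_ge0 ?(ltW b0) ?exprn_ge0 ?invr_ge0//.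
rewrite ge0_ler_powR ?nnegrE ?(ltW gam0) ?addr_ge0//.
  by rewrite !mulr_ge0 ?(ltW b0) ?exprn_ge0 ?invr_ge0.
rewrite exprVn -mulrA mulrDl mul1r lerD//; exact: grid_half_dist.
Qed.

(** The variance of a link at level k is at most B ratio^(2 k): by the Hoelder
    bound if k > 0, and because the variance of the field is bounded if k = 0. *)
Lemma link_mgf : exists2 B, 0 <= B & forall k i j t,
  (i <= 2 ^ k)%N -> (j <= 2 ^ k)%N ->
  (\int[P]_w (expR (t * `|link k i j w|))%:E <=
   (2 * expR (4 * t ^+ 2 * (B * (ratio ^+ k) ^+ 2)))%:E)%E.
Proof.
have [M hM] := variance_bounded gaussW centW contW.
have M0 : 0 <= M.
  have S0 : S (0, 0) by split; rewrite /= in_itv/= lexx ltW.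
  by apply: le_trans (hM _ S0); rewrite Rintegral_ge0// => w _; rewrite -expr2 sqr_ge0.
have K0 : 0 <= Kv * (2 * b) `^ gam by rewrite mulr_ge0// powR_ge0.
exists (M + Kv * (2 * b) `^ gam); first by rewrite addr_ge0.
have t4 (t : R) : 0 <= 4 * t ^+ 2 by rewrite pmulr_rge0// sqr_ge0.
move=> [|k] i j t ik jk.
  have Sp := grid_csquare b0 ik jk.
  have [_ _ /(_ t) h] := centered_gaussian_rv (measurable_funP (W (grid_point b 0 i j)))
    (field_gaussian_rv gaussW Sp) (centW Sp).
  apply: (le_trans h); rewrite lee_fin ler_pM2l// ler_expR expr0 expr1n mulr1.
  rewrite (ler_wpM2l (t4 t))//.
  apply: (@le_trans _ _ M); last by rewrite lerDl.
  exact: (hM _ Sp).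
have half m : (m <= 2 ^ k.+1)%N -> (m./2 <= 2 ^ k)%N.
  by move=> mk; rewrite -leq_double -[leqRHS]mul2n -expnS (leq_trans _ mk)//
    -[leqRHS]odd_double_half leq_addl.
have [_ _ /(_ t) h] := field_increment_facts gaussW centW
  (grid_csquare b0 ik jk) (grid_csquare b0 (half _ ik) (half _ jk)).
apply: (le_trans h); rewrite lee_fin ler_pM2l// ler_expR.
rewrite (ler_wpM2l (t4 t))//.
apply: (le_trans (increment_link_variance ik jk)).
by rewrite ler_wpM2r ?sqr_ge0// lerDr.
Qed.

End links.

Section chaining.
Context d (T : measurableType d) (R : realType) (P : probability T R).
Variables (b : R) (W : R * R -> {RV P >-> R}).
Hypothesis b0 : 0 < b.
Local Notation S := (csquare b).
Hypothesis gaussW : gaussian_field S W.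
Hypothesis centW : zero_mean S W.
Hypothesis contW : ae_continuous_paths S W.
Variables (gam Kv : R).
Hypotheses (gam0 : 0 < gam) (Kv0 : 0 <= Kv).
Hypothesis holderW : forall z z', S z -> S z' -> increment_variance W z z' <=
  Kv * (`|z.1 - z'.1| + `|z.2 - z'.2|) `^ gam.

Local Notation r := (ratio gam).
Local Notation link := (link b W).

Section majorant.
Variable c : R.
Hypothesis c0 : 0 < c.

(** The links at level k are measured in units of r^k, and s1 is the sum of
    all units. With the exponent c1 = c s1, the bounds on the links in
    [chain_bound] add up to a bound on c |W|. *)
Let s1 : R := (1 - r)^-1.
Let c1 : R := c * s1.

Let r0 : 0 < r. Proof. exact: ratio_gt0. Qed.
Let r1 : r < 1. Proof. exact: ratio_lt1. Qed.
Let s1_gt0 : 0 < s1. Proof. by rewrite invr_gt0 subr_gt0. Qed.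
Let c1_gt0 : 0 < c1. Proof. by rewrite mulr_gt0. Qed.

Let level k (w : T) : R := \sum_(i < (2 ^ k).+1) \sum_(j < (2 ^ k).+1)
  expR (c1 / r ^+ k * `|link k i j w|).

(** The number of links at level k is of order 4^k, so that the weight 8^-k
    makes the expectations of the terms summable. *)
Let term k (w : T) : R := 8 ^- k * level k w.

Let chain_sum (w : T) : \bar R := (\sum_(0 <= k <oo) (term k w)%:E)%E.

Let measurable_link_exp k i j :
  measurable_fun setT (fun w => expR (c1 / r ^+ k * `|link k i j w|)).
Proof.
apply: measurable_expRM; apply: measurableT_comp => //; exact: measurable_link.
Qed.

Let level_ge0 k w : 0 <= level k w.
Proof. by apply: sumr_ge0 => i _; apply: sumr_ge0 => j _; exact: expR_ge0. Qed.

Let term_ge0 k w : 0 <= term k w.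
Proof. by rewrite mulr_ge0 ?invr_ge0 ?exprn_ge0. Qed.

Let measurable_level k : measurable_fun setT (level k).
Proof. by apply: measurable_sum => i; apply: measurable_sum => j. Qed.

Let measurable_term k : measurable_fun setT (EFin \o term k).
Proof. by apply/measurable_EFinP; exact: measurable_funM. Qed.

Let measurable_chain_sum : measurable_fun setT chain_sum.
Proof.
by apply: ge0_emeasurable_sum => [k w _ _|k _]; [rewrite lee_fin|exact: measurable_term].
Qed.

Let chain_sum_ge0 w : (0 <= chain_sum w)%E.
Proof. by apply: nneseries_ge0 => k _ _; rewrite lee_fin. Qed.

Let integral_term_le : exists Q : R,
  forall k, (\int[P]_w (term k w)%:E <= (Q * 2^-1 ^+ k)%:E)%E.
Proof.
have [B B0 hB] := link_mgf b0 gaussW centW contW gam0 Kv0 holderW.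
pose Q := 2 * expR (4 * c1 ^+ 2 * B).
have Q0 : 0 <= Q by rewrite mulr_ge0// expR_ge0.
exists (4 * Q) => k.
have N0 : (0 <= (((2 ^ k).+1%:R) ^+ 2 * Q :> R)) by rewrite mulr_ge0// sqr_ge0.
under eq_integral do rewrite EFinM.
rewrite ge0_integralZl; last 4 first.
- by [].
- by apply/measurable_EFinP; exact: measurable_level.
- by move=> w _; rewrite lee_fin.
- by rewrite lee_fin invr_ge0 exprn_ge0.
have h : (\int[P]_w (level k w)%:E <= (((2 ^ k).+1%:R) ^+ 2 * Q)%:E)%E.
  under eq_integral do rewrite -sumEFin.
  rewrite ge0_integral_sum; last 3 first.
  - by [].
  - by move=> i; apply/measurable_EFinP; apply: measurable_sum => j.
  - by move=> i w _; rewrite lee_fin; apply: sumr_ge0 => j _; exact: expR_ge0.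
  apply: (@le_trans _ _ (\sum_(i < (2 ^ k).+1) \sum_(j < (2 ^ k).+1) Q%:E)%E).
    apply: lee_sum => i _; under eq_integral do rewrite -sumEFin.
    rewrite ge0_integral_sum; last 3 first.
    - by [].
    - by move=> j; apply/measurable_EFinP.
    - by move=> j w _; rewrite lee_fin expR_ge0.
    apply: lee_sum => j _.
    have ik : (i <= 2 ^ k)%N by rewrite -ltnS.
    have jk : (j <= 2 ^ k)%N by rewrite -ltnS.
    apply: (le_trans (hB _ _ _ _ ik jk)); rewrite lee_fin /Q.
    rewrite le_eqVlt; apply/orP; left; apply/eqP; congr (_ * expR _).
    rewrite expr_div_n; set y := (r ^+ k) ^+ 2.
    have y0 : y != 0 by rewrite !expf_neq0// gt_eqF.
    by field.
  under eq_bigr do rewrite sumEFin; rewrite sumEFin !sumr_const card_ord.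
  by rewrite lee_fin -mulrnA -(mulr_natl Q) natrM -expr2.
apply: (@le_trans _ _ ((8 ^- k)%:E * (((2 ^ k).+1%:R) ^+ 2 * Q)%:E)%E).
  by apply: lee_wpmul2l => //; rewrite lee_fin invr_ge0 exprn_ge0.
rewrite -EFinM lee_fin.
have e8 : 8 ^- k * (2 ^+ k) ^+ 2 = 2^-1 ^+ k :> R.
  rewrite -exprVn -exprM mulnC exprM -exprMn; congr (_ ^+ _).
  by field.
have n2 : (2 ^ k).+1%:R <= 2 * 2 ^+ k :> R.
  by rewrite mulr_natl mulr2n -natr1 natrX lerD2l exprn_ege1// ler1n.
have N2 : (2 ^ k).+1%:R ^+ 2 <= 4 * (2 ^+ k) ^+ 2 :> R.
  rewrite (_ : 4 * (2 ^+ k) ^+ 2 = (2 * 2 ^+ k) ^+ 2); last by rewrite exprMn; ring.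
  by rewrite ler_pXn2r// nnegrE ?mulr_ge0 ?exprn_ge0.
have a0 : 0 <= 8 ^- k :> R by rewrite invr_ge0 exprn_ge0.
rewrite -e8 (_ : 4 * Q * _ = 8 ^- k * (4 * (2 ^+ k) ^+ 2 * Q)); last first.
  by move: (8 ^- k) (2 ^+ k) => x y; ring.
by rewrite ler_wpM2l// ler_wpM2r.
Qed.

Let integral_chain_sum : (\int[P]_w chain_sum w < +oo)%E.
Proof.
have [Q hQ] := integral_term_le.
have Q0 : 0 <= Q.
  have := hQ 0; rewrite expr0 mulr1 -lee_fin; apply: le_trans.
  by apply: integral_ge0 => w _; rewrite lee_fin.
rewrite integral_nneseries//; last by move=> k w _; rewrite lee_fin.
apply: (@le_lt_trans _ _ (Q * 2)%:E); last by rewrite ltry.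
apply: lime_le.
  by apply: is_cvg_nneseries => k _ _; apply: integral_ge0 => w _; rewrite lee_fin.
apply: nearW => n; rewrite big_mkord.
apply: (@le_trans _ _ (\sum_(k < n) (Q * 2^-1 ^+ k)%:E)%E).
  by apply: lee_sum => k _; exact: hQ.
rewrite sumEFin lee_fin -mulr_sumr ler_wpM2l//.
have h := @sum_geometric_le R 2^-1 n.
apply: le_trans (h _ _) _.
- by rewrite invr_gt0.
- by rewrite invf_lt1// ltr1n.
- by rewrite (_ : (1 - 2^-1)^-1 = 2)//; field.
Qed.

(** On the event that the weighted sum is at most y, the links at level k are at
    most r^k (ln y + k ln 8) / c1, and these bounds are summable over k. *)
Let chain_bound w y n z : S z -> 1 <= y -> (chain_sum w <= y%:E)%E ->
  c * `|W (grid_round b n z) w| <= ln y + s1 * ln 8.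
Proof.
move=> Sz y1 hy; have y0 : 0 < y by exact: lt_le_trans y1.
have [/=] := Sz; rewrite !in_itv/= => /andP[z10 z1b] /andP[z20 z2b].
have lk k : `|link k (grid_index b k z.1) (grid_index b k z.2) w| <=
    c1^-1 * (r ^+ k * ln y + ln 8 * (k%:R * r ^+ k)).
  set i := grid_index _ _ _; set j := grid_index _ _ _.
  have ik : (i < (2 ^ k).+1)%N by rewrite ltnS grid_index_le.
  have jk : (j < (2 ^ k).+1)%N by rewrite ltnS grid_index_le.
  have h1 : expR (c1 / r ^+ k * `|link k i j w|) <= level k w.
    rewrite /level (bigD1 (Ordinal ik))//= (bigD1 (Ordinal jk))//=.
    rewrite -addrA lerDl; apply: addr_ge0.
      by apply: sumr_ge0 => *; exact: expR_ge0.
    by apply: sumr_ge0 => *; apply: sumr_ge0 => *; exact: expR_ge0.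
  have h2 : term k w <= y.
    rewrite -lee_fin; apply: le_trans hy.
    apply: le_trans (nneseries_lim_ge (m := 0) k.+1 _); last by move=> *; rewrite lee_fin.
    rewrite big_nat_recr//= leeDr// sume_ge0// => *; by rewrite lee_fin.
  have h3 : expR (c1 / r ^+ k * `|link k i j w|) <= 8 ^+ k * y.
    apply: (le_trans h1); move: h2.
    by rewrite /term mulrC ler_pdivrMr ?exprn_gt0// mulrC.
  have rk : 0 < r ^+ k by rewrite exprn_gt0.
  have h4 : c1 / r ^+ k * `|link k i j w| <= ln y + k%:R * ln 8.
    rewrite mulr_natl -(lnXn k (x := 8))// addrC -lnM ?posrE ?exprn_gt0//.
    rewrite -ler_expR lnK// posrE mulr_gt0// exprn_gt0//.
  rewrite -(ler_pM2l (divr_gt0 c1_gt0 rk)); apply: (le_trans h4).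
  rewrite le_eqVlt; apply/orP; left; apply/eqP; field.
  by rewrite !gt_eqF.
have ly : 0 <= ln y by rewrite ln_ge0.
have l8 : 0 <= ln 8 :> R by rewrite ln_ge0// ler1n.
rewrite link_sum//; apply: (@le_trans _ _ (c * (c1^-1 *
    \sum_(k < n.+1) (r ^+ k * ln y + ln 8 * (k%:R * r ^+ k))))).
  rewrite ler_pM2l// mulr_sumr (le_trans (ler_norm_sum _ _ _))//.
  by apply: ler_sum => k _; exact: lk.
rewrite big_split/= -mulr_suml -mulr_sumr.
have -> : c * (c1^-1 * ((\sum_(k < n.+1) r ^+ k) * ln y +
    ln 8 * \sum_(k < n.+1) k%:R * r ^+ k)) = (1 - r) *
  ((\sum_(k < n.+1) r ^+ k) * ln y + ln 8 * \sum_(k < n.+1) k%:R * r ^+ k).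
  by rewrite /c1 invfM invrK mulrA mulrA mulfV ?gt_eqF// mul1r.
have g1 := sum_geometric_le n.+1 r0 r1.
have g2 := sum_arith_geometric_le n.+1 r0 r1.
have d1 : 0 < 1 - r by rewrite subr_gt0.
apply: (@le_trans _ _ ((1 - r) * ((1 - r)^-1 * ln y + ln 8 * (1 - r) ^- 2))).
  by rewrite ler_pM2l// lerD// ?ler_wpM2r// ler_wpM2l.
rewrite le_eqVlt; apply/orP; left; apply/eqP; rewrite /s1; field.
by rewrite gt_eqF.
Qed.

(** This is [chain_bound] exponentiated, with y = 1 + chain_sum w to have 1 <=
    y, in the limit of fine grids. *)
Lemma chaining_majorant : exists Z : T -> \bar R,
  [/\ measurable_fun setT Z, forall w, (0 <= Z w)%E, (\int[P]_w Z w < +oo)%E &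
      {ae P, forall w z, S z -> ((expR (c * `|W z w|))%:E <= Z w)%E}].
Proof.
pose K := expR (s1 * ln 8); have K0 : 0 < K by exact: expR_gt0.
exists (fun w => K%:E * (1 + chain_sum w))%E; split.
- by apply: measurable_funeM; exact: emeasurable_funD.
- by move=> w; rewrite mule_ge0 ?lee_fin ?(ltW K0)// adde_ge0.
- rewrite ge0_integralZl; last 4 first.
  + by [].
  + exact: emeasurable_funD.
  + by move=> w _; rewrite adde_ge0.
  + by rewrite lee_fin ltW.
  rewrite ge0_integralD// integral_cst//= probability_setT mul1e.
  rewrite lte_mul_pinfty ?lee_fin ?(ltW K0)// lte_add_pinfty ?ltry//.
apply: filterS contW => w /within_continuous_on_csquare cw z Sz.
have := chain_sum_ge0 w; case E : (chain_sum w) => [y| |]// y0; last first.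
  by rewrite addey// gt0_muley ?leey ?lte_fin.
rewrite -EFinD -EFinM lee_fin.
have y1 : 1 <= 1 + y by rewrite lerDl.
have hy : (chain_sum w <= (1 + y)%:E)%E by rewrite E lee_fin lerDr.
have y10 : 0 < 1 + y by exact: lt_le_trans y1.
rewrite -(lnK (x := 1 + y)) ?posrE// /K -expRD ler_expR addrC.
have cv : c * `|W (grid_round b n z) w| @[n --> \oo] --> c * `|W z w|.
  by apply: cvgMr; apply: cvg_norm; exact: (cvg_continuous_on_csquare b0 cw Sz).
rewrite -(cvg_lim _ cv)//; apply: limr_le; first by apply/cvgP: cv.
by apply: nearW => n; exact: chain_bound.
Qed.

End majorant.
End chaining.

(** * Exponential moments of the supremum of the field *)

Section field_majorant.
Context d (T : measurableType d) (R : realType) (P : probability T R).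
Variables (b : R) (W : R * R -> {RV P >-> R}) (lam : nat -> R)
  (e : nat -> R * R -> R) (alpha beta C L : R).
Hypotheses (b0 : 0 < b) (alpha0 : 0 < alpha) (beta0 : 0 < beta) (C0 : 0 < C).
Local Notation S := (csquare b).
Hypothesis gaussW : gaussian_field S W.
Hypothesis centW : zero_mean S W.
Hypothesis contW : ae_continuous_paths S W.
Hypothesis eigen : eigenpairs_of b W lam e.
Hypothesis C1e : forall i, C1_csquare b (e i).
Hypothesis eC : forall i, (Linfty_norm b (e i) <= C%:E)%E.
Hypothesis gradC : forall i,
  (Linfty_norm b (grad_norm (e i)) <= (C * i.+1%:R `^ alpha)%:E)%E.

Let ce i : continuous_on_csquare b (e i).
Proof. by apply: within_continuous_on_csquare; have [] := C1e i. Qed.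

Let eC' i z : S z -> `|e i z| <= C.
Proof. by apply: Linfty_norm_le_csquare => //; have [] := C1e i. Qed.

Lemma field_eigenvalue_ge0 i : 0 <= lam i.
Proof. exact: (eigenvalue_ge0 b0 gaussW centW contW eigen ce eC'). Qed.

Hypothesis sumL : forall N, \sum_(i < N) lam i * i.+1%:R `^ beta <= L.

(** By [mercer], the variance of an increment is the sum of the lam i * (e i z
    - e i z')^2. The factor i^beta in the summability condition pays for a
    fractional power of the Lipschitz constant i^alpha of e i. *)
Lemma field_increment_holder z z' : S z -> S z' ->
  increment_variance W z z' <= 4 * C ^+ 2 * L *
    (`|z.1 - z'.1| + `|z.2 - z'.2|) `^ Num.min 2 (beta / alpha).
Proof.
move=> Sz Sz'; set h := _ + _; have h0 : 0 <= h by rewrite addr_ge0.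
have n1 i : 1 <= i.+1%:R :> R by rewrite ler1n.
have lam_sum : exists L, forall N, \sum_(i < N) lam i <= L.
  exists L => N; apply: le_trans (sumL N); apply: ler_sum => i _.
  rewrite ler_peMr ?field_eigenvalue_ge0//.
  by rewrite -[leLHS](powRr0 i.+1%:R) ler_powR// ltW.
apply: (increment_variance_le_sum b0 gaussW centW contW eigen ce eC' lam_sum) => // N.
apply: (@le_trans _ _ (\sum_(i < N) (lam i * i.+1%:R `^ beta) *
    (4 * C ^+ 2 * h `^ Num.min 2 (beta / alpha)))).
  apply: ler_sum => i _; rewrite -[leRHS]mulrA ler_wpM2l ?field_eigenvalue_ge0//.
  have x1 : `|e i z - e i z'| <= 2 * C.
    rewrite mulr_natl mulr2n (le_trans (ler_normB _ _))// lerD//; exact: eC'.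
  have x2 : `|e i z - e i z'| <= C * i.+1%:R `^ alpha * h.
    exact: (C1_csquare_lipschitz b0 (C1e i) (gradC i)).
  have := sqr_interpolation alpha0 beta0 (n1 i) h0 (ltW C0) x1 x2.
  by rewrite [leRHS]mulrCA.
rewrite -mulr_suml mulrC [leRHS]mulrAC ler_wpM2l//.
by rewrite !mulr_ge0 ?powR_ge0 ?(ltW C0).
Qed.

(** All exponential moments of the supremum of the field are finite. The bound
    by Z replaces the supremum, which is measurable only up to null sets. *)
Lemma field_exponential_majorant c : 0 < c -> exists Z : T -> \bar R,
  [/\ measurable_fun setT Z, forall w, (0 <= Z w)%E, (\int[P]_w Z w < +oo)%E &
      {ae P, forall w z, S z -> ((expR (c * `|W z w|))%:E <= Z w)%E}].
Proof.
move=> c0; have L0 : 0 <= L by have := sumL 0; rewrite big_ord0.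
apply: (chaining_majorant b0 gaussW centW contW _ _ field_increment_holder c0).
- by rewrite lt_min ltr0n divr_gt0.
- by rewrite !mulr_ge0 ?(ltW C0).
Qed.

End field_majorant.

(** * Essential suprema as integrands *)

Section lower_integral.
Import HBNNSimple.

(** The integral of a nonnegative function is defined by approximation from
    below by simple functions, so that this comparison needs measurability of
    the larger function only. *)
Lemma integral_le_ae_majorant d (T : measurableType d) (R : realType)
    (mu : {measure set T -> \bar R}) (f g : T -> \bar R) :
  (forall w, 0 <= f w)%E -> measurable_fun setT g -> (forall w, 0 <= g w)%E ->
  {ae mu, forall w, (f w <= g w)%E} ->
  (\int[mu]_w f w <= \int[mu]_w g w)%E.
Proof.
move=> f0 mg g0 fg; rewrite ge0_integralTE//; apply: ge_ereal_sup => _ [h hf <-].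
have -> : sintegral mu h = (\int[mu]_w (h w)%:E)%E.
  by rewrite integral_nnsfun// patch_setT.
apply: ae_ge0_le_integral => //.
- by move=> w _; rewrite lee_fin.
- exact/measurable_EFinP.
- by apply: filterS fg => w fgw _; exact: le_trans (hf w) fgw.
Qed.

End lower_integral.

Section ess_sup_osquare.
Context {R : realType}.
Variable D : R.
Hypothesis D0 : 0 < D.
Local Notation mu := (@lebesgue_measure R \x @lebesgue_measure R)%E.
Local Notation ess_sup_D := (ess_sup (mrestr mu (measurable_osquare D))).

Lemma ess_sup_osquare_le (F : R * R -> \bar R) (y : \bar R) :
  (forall z, osquare D z -> F z <= y)%E -> (ess_sup_D F <= y)%E.
Proof.
move=> Fy; apply/ess_supP; exists (~` osquare D); split.
- by apply: measurableC; exact: measurable_osquare.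
- transitivity (mu (~` osquare D `&` osquare D)) => //.
  by rewrite setICl measure0.
- by move=> z /= h oz; apply: h; exact: Fy.
Qed.

Lemma ess_sup_osquare_ge0 (F : R * R -> \bar R) :
  (forall z, 0 <= F z)%E -> (0 <= ess_sup_D F)%E.
Proof.
move=> F0; apply: ess_sup_gee; last exact: aeW.
suff e : mrestr mu (measurable_osquare D) setT = (D * D)%:E.
  by apply: lt_le_trans (_ : 0 < (D * D)%:E)%E _; rewrite ?lte_fin ?mulr_gt0// -e.
transitivity (mu (setT `&` osquare D)) => //.
rewrite setTI product_measure1E; try exact: measurable_itv.
by rewrite /= !lebesgue_measure_itv/= !lte_fin D0 -!EFinD -EFinM oppr0 !addr0.
Qed.

End ess_sup_osquare.

(** * Domination of the diffusion coefficient *)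

Section nonlinearities.
Context {R : realType}.

(** Mean value theorem between 0 and x, the factor |x| being absorbed by exp
    |x|. *)
Lemma Phi1_growth (Phi : R -> R) (phi psi : R) :
  (forall x, derivable Phi x 1) -> 0 < phi -> 0 < psi ->
  (forall x, `|derive1 Phi x| <= phi * expR (psi * `|x|)) ->
  forall x, Phi x <= Phi 0 + phi * expR ((psi + 1) * `|x|).
Proof.
move=> dPhi phi0 psi0 dbound x; rewrite -lerBlDl.
have [c cx ->] : exists2 c : R, `|c| <= `|x| & Phi x - Phi 0 = derive1 Phi c * x.
  have id (c : R) : is_derive c 1 Phi (derive1 Phi c).
    by rewrite derive1E; apply: DeriveDef; [exact: dPhi|].
  have cont (a b' : R) : {within `[a, b'], continuous Phi}.
    by apply: derivable_within_continuous => t _; exact: dPhi.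
  have [x0|/ltW x0] := leP 0 x.
    have [c] := MVT_segment x0 (fun c _ => id c) (cont 0 x).
    rewrite in_itv/= subr0 => /andP[c0 cx] e; exists c => //.
    by rewrite !ger0_norm.
  have [c] := MVT_segment x0 (fun c _ => id c) (cont x 0).
  rewrite in_itv/= sub0r => /andP[xc c0] e; exists c.
    by rewrite !ler0_norm// lerN2.
  by rewrite -opprB e mulrN opprK.
apply: (le_trans (ler_norm _)); rewrite normrM mulrDl mul1r expRD mulrA.
apply: ler_pM => //.
  apply: (le_trans (dbound c)); rewrite ler_pM2l// ler_expR.
  by rewrite ler_pM2l.
by apply: le_trans (expR_ge1Dx _); rewrite lerDr.
Qed.

Lemma Phi2_growth (Phi : R -> R) (Clip c : R) : 0 < Clip -> 1 <= c ->
  (forall x y, `|Phi x - Phi y| <= Clip * `|x - y|) ->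
  forall x, Phi x <= Phi 0 + Clip * expR (c * `|x|).
Proof.
move=> Clip0 c1 lip x; rewrite -lerBlDl.
apply: (le_trans (ler_norm _)); apply: (le_trans (lip x 0)).
rewrite subr0 ler_pM2l//; apply: (@le_trans _ _ (expR `|x|)).
  by apply: le_trans (expR_ge1Dx _); rewrite lerDr.
by rewrite ler_expR ler_peMl.
Qed.

End nonlinearities.

Section coefficient_bounds.
Context {R : realType}.

(** The sum of the two exponentials is at most twice the larger one. *)
Lemma powR_sum_le (A x y c p : R) : 0 < A -> 0 < p -> 0 <= x -> 0 <= y ->
  (A * (expR (c * x) + expR (c * y))) `^ p <=
  (2 * A) `^ p * (expR (p * c * x) + expR (p * c * y)).
Proof.
move=> A0 p0 x0 y0.
have key m : m = expR (c * x) \/ m = expR (c * y) ->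
    m `^ p <= expR (p * c * x) + expR (p * c * y).
  by case=> ->; rewrite -expRM mulrC mulrA (lerDl, lerDr) expR_ge0.
set m := Num.max (expR (c * x)) (expR (c * y)).
have m0 : 0 <= m by rewrite le_max expR_ge0.
apply: (@le_trans _ _ ((2 * A) `^ p * m `^ p)).
  rewrite -powRM ?mulr_ge0 ?(ltW A0)//.
  rewrite ge0_ler_powR ?nnegrE ?(ltW p0) ?mulr_ge0 ?addr_ge0 ?expR_ge0 ?(ltW A0)//.
  rewrite (mulrC 2) -mulrA ler_pM2l// mulr_natl mulr2n lerD// le_max lexx ?orbT//.
rewrite ler_wpM2l ?powR_ge0// key// /m.
by case: (leP (expR (c * x)) (expR (c * y))) => _; [right|left].
Qed.

Lemma sum_growth (a u f v g x1 x2 c p1 p2 : R) :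
  0 <= a -> 0 <= u -> 0 <= f -> 0 <= v -> 0 <= g -> 1 <= x1 -> 1 <= x2 ->
  c <= a -> p1 <= u + f * x1 -> p2 <= v + g * x2 ->
  c + p1 + p2 <= (a + u + f + v + g) * (x1 + x2).
Proof.
move=> a0 u0 f0 v0 g0 x1_ge1 x2_ge1 ca h1 h2.
have x1_ge0 : 0 <= x1 by exact: le_trans x1_ge1.
have x2_ge0 : 0 <= x2 by exact: le_trans x2_ge1.
have : u <= u * x1 by rewrite ler_peMr.
have : v <= v * x2 by rewrite ler_peMr.
have : a <= a * x1 by rewrite ler_peMr.
have := mulr_ge0 u0 x2_ge0; have := mulr_ge0 v0 x1_ge0.
have := mulr_ge0 f0 x2_ge0; have := mulr_ge0 g0 x1_ge0.
have := mulr_ge0 a0 x2_ge0.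
by rewrite !mulrDl !mulrDr; lra.
Qed.

(** Above the level A the excess is at most x, hence at most x (x / A). *)
Lemma cutoff_error_powR (A x p : R) : 0 < A -> 0 <= x -> 0 < p ->
  `|x - cutoff A x| `^ p <= A `^ (- p) * x `^ (2 * p).
Proof.
move=> A0 x0 p0; rewrite /cutoff; case: (leP x A) => xA.
  by rewrite subrr normr0 powR0 ?gt_eqF// mulr_ge0// powR_ge0.
rewrite powRrM powR_mulrn// powRN -powR_inv1 ?powR_ge0//.
rewrite -powRrM mulrN1 -mulN1r powRrM powR_inv1 ?(ltW A0)//.
rewrite -powRM ?invr_ge0 ?sqr_ge0 ?(ltW A0)// ge0_ler_powR ?nnegrE ?(ltW p0)//.
  by rewrite mulr_ge0 ?invr_ge0 ?sqr_ge0 ?(ltW A0).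
rewrite ger0_norm ?subr_ge0 ?(ltW xA)// mulrC ler_pdivlMr//.
by nra.
Qed.

End coefficient_bounds.

Section coefficient_majorant.
Context d (T : measurableType d) (R : realType) (P : probability T R).
Variables (D K : R) (W1 W2 : R * R -> {RV P >-> R}) (l1 l2 : R -> {RV P >-> R}).
Variables (abar : R * R -> R) (Phi1 Phi2 : R -> R) (phi psi Clip am ap : R).
Hypotheses (D0 : 0 < D) (K0 : 0 < K) (phi0 : 0 < phi) (psi0 : 0 < psi)
  (Clip0 : 0 < Clip) (am0 : 0 < am).
Hypotheses (Phi1_ge0 : forall x, 0 <= Phi1 x) (Phi2_ge0 : forall x, 0 <= Phi2 x).
Hypothesis abar_bound : forall z, osquare D z -> am <= abar z <= ap.
Hypothesis Phi1_le : forall x, Phi1 x <= Phi1 0 + phi * expR ((psi + 1) * `|x|).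
Hypothesis Phi2_le : forall x, Phi2 x <= Phi2 0 + Clip * expR ((psi + 1) * `|x|).
Hypotheses (sub1 : levy_subordinator D l1) (sub2 : levy_subordinator D l2).
Hypothesis majorant1 : forall c, 0 < c -> exists Z : T -> \bar R,
  [/\ measurable_fun setT Z, forall w, (0 <= Z w)%E, (\int[P]_w Z w < +oo)%E &
      {ae P, forall w z, csquare D z -> ((expR (c * `|W1 z w|))%:E <= Z w)%E}].
Hypothesis majorant2 : forall c, 0 < c -> exists Z : T -> \bar R,
  [/\ measurable_fun setT Z, forall w, (0 <= Z w)%E, (\int[P]_w Z w < +oo)%E &
      {ae P, forall w z, csquare K z -> ((expR (c * `|W2 z w|))%:E <= Z w)%E}].
Local Notation a_K := (coef_K abar Phi1 Phi2 W1 W2 l1 l2 K).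

(** A path that is nondecreasing and starts at 0 is nonnegative. *)
Lemma subordinator_cutoff (l : R -> {RV P >-> R}) : levy_subordinator D l ->
  {ae P, forall w t, 0 < t < D -> 0 <= cutoff K (l t w) <= K}.
Proof.
move=> [[l0 _ _ _] lnd _]; apply: filterS2 l0 lnd => w l0 lnd t /andP[t0 tD].
rewrite /cutoff ge_min lexx orbT andbT le_min (ltW K0) andbT -l0.
by apply: lnd; rewrite ?in_itv/= ?lexx ?ltW// (lt_trans t0).
Qed.

Lemma coef_K_ge0 w z : osquare D z -> 0 <= a_K w z.
Proof.
move=> /abar_bound/andP[h _]; rewrite /coef_K !addr_ge0//.
by apply: le_trans h; exact: ltW.
Qed.

Let A0 := ap + Phi1 0 + phi + Phi2 0 + Clip.

Let A0_gt0 : 0 < A0.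
Proof.
have oz : osquare D (D / 2, D / 2).
  by split; rewrite /= in_itv/= divr_gt0//= ltr_pdivrMr// ltr_pMr// ltr1n.
have /andP[h1 h2] := abar_bound oz.
have ap0 : 0 <= ap by apply: le_trans (ltW am0) (le_trans h1 h2).
by rewrite /A0 ltr_wpDl// !addr_ge0// ltW.
Qed.

Lemma coef_K_le w z : osquare D z ->
  a_K w z <= A0 * (expR ((psi + 1) * `|W1 z w|) + expR ((psi + 1) *
    `|W2 (cutoff K (l1 z.1 w), cutoff K (l2 z.2 w)) w|)).
Proof.
move=> oz; have /andP[_ h] := abar_bound oz; rewrite /coef_K.
have ge1 (x : R) : 1 <= expR ((psi + 1) * `|x|).
  by rewrite -expR0 ler_expR mulr_ge0// addr_ge0// ltW.
apply: sum_growth => //; try exact: ltW.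
by have /andP[g1 g2] := abar_bound oz; exact: le_trans (ltW am0) (le_trans g1 g2).
Qed.

(** The p-th power of the bound in [coef_K_le] is controlled, at all points of
    the square at once, by the majorants of the two fields for c = p (psi +
    1). *)
Lemma coef_K_majorant (p : R) : 0 < p -> exists G : T -> \bar R,
  [/\ measurable_fun setT G, forall w, (0 <= G w)%E, (\int[P]_w G w < +oo)%E &
      {ae P, forall w z, osquare D z -> ((a_K w z `^ p)%:E <= G w)%E}].
Proof.
move=> p0; have c0 : 0 < p * (psi + 1) by rewrite mulr_gt0// addr_gt0.
have [Z1 [mZ1 Z10 iZ1 hZ1]] := majorant1 c0.
have [Z2 [mZ2 Z20 iZ2 hZ2]] := majorant2 c0.
have B0 : 0 <= (2 * A0) `^ p by exact: powR_ge0.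
exists (fun w => ((2 * A0) `^ p)%:E * (Z1 w + Z2 w))%E; split.
- by apply: measurable_funeM; exact: emeasurable_funD.
- by move=> w; rewrite mule_ge0// adde_ge0.
- rewrite ge0_integralZl; last 4 first.
  + by [].
  + exact: emeasurable_funD.
  + by move=> w _; rewrite adde_ge0.
  + by [].
  by rewrite ge0_integralD// lte_mul_pinfty// lte_add_pinfty.
have h1 := subordinator_cutoff sub1; have h2 := subordinator_cutoff sub2.
apply: filterS2 (filterI hZ1 hZ2) (filterI h1 h2) => w [z1 z2] [c1 c2] z oz.
have [/=] := oz; rewrite !in_itv/= => o1 o2.
have Sz : csquare D z by exact: osquare_csquare.
pose y := (cutoff K (l1 z.1 w), cutoff K (l2 z.2 w)).
have Sy : csquare K y by split; rewrite /= in_itv/=; [exact: c1|exact: c2].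
apply: (@le_trans _ _ ((2 * A0) `^ p * (expR (p * (psi + 1) * `|W1 z w|) +
   expR (p * (psi + 1) * `|W2 y w|)))%:E).
  rewrite lee_fin; apply: le_trans (powR_sum_le (psi + 1) A0_gt0 p0 _ _) => //.
  rewrite ge0_ler_powR ?nnegrE ?(ltW p0) ?coef_K_ge0//; last exact: coef_K_le.
  by rewrite mulr_ge0 ?(ltW A0_gt0)// addr_ge0 ?expR_ge0.
rewrite EFinM; apply: lee_wpmul2l; first by rewrite lee_fin.
by rewrite EFinD; apply: leeD; [exact: z1|exact: z2].
Qed.

End coefficient_majorant.

Theorem theorem5p4 (d : measure_display) (T : measurableType d) (R : realType)
  (P : probability T R) (D K : R)
  (W1 W2 : R * R -> {RV P >-> R}) (l1 l2 : R -> {RV P >-> R})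
  (abar : R * R -> R) (Phi1 Phi2 : R -> R)
  (lam1 lam2 : nat -> R) (e1 e2 : nat -> R * R -> R)
  (alpha beta Ce Clam phi psi Clip am ap : R) :
  measure_is_complete P ->
  0 < D -> 0 < K ->
  independent_sigma P (rv_events (csquare D) W1) (rv_events (csquare K) W2) ->
  gaussian_field (csquare D) W1 -> gaussian_field (csquare K) W2 ->
  zero_mean (csquare D) W1 -> zero_mean (csquare K) W2 ->
  ae_continuous_paths (csquare D) W1 -> ae_continuous_paths (csquare K) W2 ->
  eigenpairs_of D W1 lam1 e1 -> eigenpairs_of K W2 lam2 e2 ->
  (forall i, C1_csquare D (e1 i)) -> (forall i, C1_csquare K (e2 i)) ->
  0 < alpha -> 0 < beta -> 0 < Ce -> 0 < Clam ->
  (forall i, (Linfty_norm D (e1 i) <= Ce%:E)%E) ->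
  (forall i, (Linfty_norm K (e2 i) <= Ce%:E)%E) ->
  (forall i, (Linfty_norm D (grad_norm (e1 i)) <= (Ce * i.+1%:R `^ alpha)%:E)%E) ->
  (forall i, (Linfty_norm K (grad_norm (e2 i)) <= (Ce * i.+1%:R `^ alpha)%:E)%E) ->
  (\sum_(0 <= i <oo) ((lam1 i + lam2 i) * i.+1%:R `^ beta)%:E <= Clam%:E)%E ->
  0 < phi -> 0 < psi -> 0 < Clip ->
  (forall x, 0 <= Phi1 x) -> (forall x, 0 <= Phi2 x) ->
  continuous Phi1 -> continuous Phi2 ->
  (forall x, derivable Phi1 x 1) -> continuous (derive1 Phi1) ->
  (forall x, `|derive1 Phi1 x| <= phi * expR (psi * `|x|)) ->
  (forall x y, `|Phi2 x - Phi2 y| <= Clip * `|x - y|) ->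
  0 < am -> {within osquare D, continuous abar} ->
  (forall z, osquare D z -> am <= abar z <= ap) ->
  levy_subordinator D l1 -> levy_subordinator D l2 ->
  independent_sigma P
    (rv_events `[0, D] l1 `|` rv_events `[0, D] l2)
    (rv_events (csquare D) W1 `|` rv_events (csquare K) W2) ->
  let a_K := coef_K abar Phi1 Phi2 W1 W2 l1 l2 K in
  let a_KA := coef_KA abar Phi1 Phi2 W1 W2 l1 l2 K in
  let ess_sup_D := ess_sup (mrestr lebesgue2 (measurable_osquare D)) in
  forall n : R, 1 < n ->
    ((\int[P]_w ess_sup_D (fun z => (a_K w z `^ n)%:E)) `^ n^-1 < +oo)%E /\
    forall delta : R, 0 < delta -> exists2 A : R, 0 < A &
      ((\int[P]_w ess_sup_D (fun z => (`|a_K w z - a_KA A w z| `^ n)%:E))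
         `^ n^-1 < delta%:E)%E.
Proof.
move=> _ D0 K0 _ gW1 gW2 cW1 cW2 pW1 pW2 eig1 eig2 C1e1 C1e2 alpha0 beta0 Ce0 _
  e1C e2C g1C g2C sumlam phi0 psi0 Clip0 Phi1_ge0 Phi2_ge0 _ _ dPhi1 _ dPhi1_le
  Phi2_lip am0 _ abar_bound sub1 sub2 _ a_K a_KA ess_sup_D n n1.
have n0 : 0 < n by exact: lt_trans n1.
have lam1_ge0 := field_eigenvalue_ge0 D0 gW1 cW1 pW1 eig1 C1e1 e1C.
have lam2_ge0 := field_eigenvalue_ge0 K0 gW2 cW2 pW2 eig2 C1e2 e2C.
(* since all eigenvalues are nonnegative, the joint summability condition
   bounds the partial sums for each field *)
have sum12 N : \sum_(i < N) (lam1 i + lam2 i) * i.+1%:R `^ beta <= Clam.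
  rewrite -lee_fin -sumEFin -(big_mkord xpredT
    (fun i => ((lam1 i + lam2 i) * i.+1%:R `^ beta)%:E)).
  apply: le_trans sumlam; apply: nneseries_lim_ge => i _ _.
  by rewrite lee_fin mulr_ge0 ?powR_ge0// addr_ge0.
have sum1 N : \sum_(i < N) lam1 i * i.+1%:R `^ beta <= Clam.
  apply: le_trans (sum12 N); apply: ler_sum => i _.
  by rewrite ler_wpM2r ?powR_ge0// lerDl.
have sum2 N : \sum_(i < N) lam2 i * i.+1%:R `^ beta <= Clam.
  apply: le_trans (sum12 N); apply: ler_sum => i _.
  by rewrite ler_wpM2r ?powR_ge0// lerDr.
have maj1 := field_exponential_majorant D0 alpha0 beta0 Ce0 gW1 cW1 pW1 eig1
  C1e1 e1C g1C sum1.
have maj2 := field_exponential_majorant K0 alpha0 beta0 Ce0 gW2 cW2 pW2 eig2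
  C1e2 e2C g2C sum2.
have Phi1_le := Phi1_growth dPhi1 phi0 psi0 dPhi1_le.
have psi1 : 1 <= psi + 1 by rewrite lerDr ltW.
have Phi2_le := Phi2_growth Clip0 psi1 Phi2_lip.
have maj p (p0 : 0 < p) := coef_K_majorant D0 K0 phi0 psi0 Clip0 am0 Phi1_ge0
  Phi2_ge0 abar_bound Phi1_le Phi2_le sub1 sub2 maj1 maj2 p0.
split.
  have [G [mG G0 iG hG]] := maj n n0.
  apply: poweR_lty; apply: le_lt_trans iG; apply: integral_le_ae_majorant => //.
    by move=> w; apply: ess_sup_osquare_ge0 => // z; rewrite lee_fin powR_ge0.
  by apply: filterS hG => w hw; apply: ess_sup_osquare_le; exact: hw.
move=> delta delta0; have n20 : 0 < 2 * n by rewrite mulr_gt0.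
have [G [mG G0 iG hG]] := maj _ n20.
have Gfin : (\int[P]_w G w)%E \is a fin_num.
  by rewrite ge0_fin_numE// integral_ge0.
pose j := fine (\int[P]_w G w)%E; have j0 : 0 <= j by rewrite fine_ge0// integral_ge0.
have dn0 : 0 < delta `^ n by exact: powR_gt0.
(* then A^-n j = delta^n j / (j + 1) *)
pose A := ((j + 1) / delta `^ n) `^ n^-1.
have A0 : 0 < A by rewrite powR_gt0// divr_gt0// ltr_wpDl.
have An : A `^ (- n) * j < delta `^ n.
  rewrite powRN /A -powRrM mulVf ?gt_eqF// powRr1; last first.
    by rewrite divr_ge0 ?(ltW dn0)// addr_ge0.
  rewrite invfM invrK mulrAC gtr_pMl// mulrC ltr_pdivrMr ?mul1r ?ltrDl//.
  by rewrite ltr_wpDl.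
exists A => //.
have le_I : (\int[P]_w ess_sup_D (fun z => (`|a_K w z - a_KA A w z| `^ n)%:E) <=
    (A `^ (- n) * j)%:E)%E.
  apply: (@le_trans _ _ (\int[P]_w ((A `^ (- n))%:E * G w))%E); last first.
    by rewrite ge0_integralZl ?lee_fin ?powR_ge0// EFinM /j fineK.
  apply: integral_le_ae_majorant.
  - by move=> w; apply: ess_sup_osquare_ge0 => // z; rewrite lee_fin powR_ge0.
  - exact: measurable_funeM.
  - by move=> w; rewrite mule_ge0// lee_fin powR_ge0.
  apply: filterS hG => w hw; apply: ess_sup_osquare_le => z oz.
  apply: (@le_trans _ _ (A `^ (- n) * a_K w z `^ (2 * n))%:E).
    rewrite lee_fin; apply: cutoff_error_powR => //.
    exact: (coef_K_ge0 K W1 W2 l1 l2 am0 Phi1_ge0 Phi2_ge0 abar_bound w oz).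
  by rewrite EFinM; apply: lee_wpmul2l; [rewrite lee_fin powR_ge0|exact: hw].
have I0 : (0 <= \int[P]_w ess_sup_D (fun z => (`|a_K w z - a_KA A w z| `^ n)%:E))%E.
  by apply: integral_ge0 => w _; apply: ess_sup_osquare_ge0.
move: le_I I0; case: (\int[P]_w _)%E => [i| |]//; rewrite !lee_fin => le_i i0.
rewrite poweR_EFin lte_fin.
have -> : delta = (delta `^ n) `^ n^-1.
  by rewrite -powRrM mulfV ?gt_eqF// powRr1// ltW.
by apply: gt0_ltr_powR; rewrite ?invr_gt0 ?nnegrE ?(ltW dn0)//; exact: le_lt_trans An.
Qed.
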